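(* Let $\mathcal{A}$ be a pre-2-filtered 2-category, $F:\mathcal{A}\to\mathrm{Cat}$ a 2-functor, and $\mathcal{P}$ a finite category. Let $F^{\mathcal{P}}:\mathcal{A}\to\mathrm{Cat}$ be the 2-functor defined by $F^{\mathcal{P}}(A)=(FA)^{\mathcal{P}}$, and let $$\Diamond:\mathcal{L}(F^{\mathcal{P}})\to\mathcal{L}(F)^{\mathcal{P}}$$ be the canonical functor. Then $\Diamond$ is an equivalence of categories provided that $\mathcal{A}$ is 2-filtered, or that $\mathcal{A}$ is pseudo 2-filtered and $\mathcal{P}$ is connected.
   Context: 2-categories and 2-functors are strict; $\mathrm{Cat}$ is the 2-category of categories, functors and natural transformations; $\mathcal{X}^{\mathcal{P}}$ is the category of functors $\mathcal{P}\to\mathcal{X}$. Consider the following axioms on a 2-category $\mathcal{A}$. (F0) For all objects $A,B$ there exist an object $C$ and arrows $A\to C$, $B\to C$. (F1) For all arrows $f:E\to A$, $g:E\to B$ there exist $u:A\to C$, $v:B\to C$ and an invertible 2-cell $\gamma:uf\Rightarrow vg$. (FF1) For all arrows $f_1:E_1\to A$, $g_1:E_1\to B$, $f_2:E_2\to A$, $g_2:E_2\to B$ there exist $u:A\to C$, $v:B\to C$ and invertible 2-cells $\gamma_1:uf_1\Rightarrow vg_1$, $\gamma_2:uf_2\Rightarrow vg_2$. (F2) For all arrows $f:E\to A$, $g:E\to B$, $u_i:A\to C_i$, $v_i:B\to C_i$ and all 2-cells $\gamma_i:u_if\Rightarrow v_ig$ ($i=1,2$) there exist $w_1:C_1\to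 C$, $w_2:C_2\to C$ and invertible 2-cells $\alpha:w_1v_1\Rightarrow w_2v_2$, $\beta:w_1u_1\Rightarrow w_2u_2$ such that $(\alpha g)\circ(w_1\gamma_1)=(w_2\gamma_2)\circ(\beta f)$. (F3) For data as in (F2) with $B=A$, $u_1=v_1$, $u_2=v_2$, there exist $w_1:C_1\to C$, $w_2:C_2\to C$ and a single invertible 2-cell $\varepsilon:w_1u_1\Rightarrow w_2u_2$ such that $(\varepsilon g)\circ(w_1\gamma_1)=(w_2\gamma_2)\circ(\varepsilon f)$. $\mathcal{A}$ is pre-2-filtered if it satisfies F1 and F2; pseudo 2-filtered if it satisfies FF1, F2 and F3; 2-filtered if it is pseudo 2-filtered, non-empty, and satisfies F0. Notation: for a 2-functor $F:\mathcal{A}\to\mathrm{Cat}$, write $ux=F(u)(x)$, $u\xi=F(u)(\xi)$ and $\alpha x=F(\alpha)_x$. The category $\mathcal{L}(F)$ (for $\mathcal{A}$ pre-2-filtered): objects are pairs $(x,A)$ with $A\in\mathcal{A}$, $x\in FA$. A premorphism $(x,A)\to(y,B)$ is a triple $(u,\xi,v)$ with $u:A\to C$, $v:B\to C$ in $\mathcal{A}$ and $\xi:ux\to vy$ in $FC$. A homotopy $(u_1,\xi_1,v_1)\Rightarrow(u_2,\xi_2,v_2)$ between premorphisms $(x,A)\to(y,B)$ (with $u_i,v_i$ having codomain $C_i$) is a quadruple $(w_1,w_2,\alpha,\beta)$ with $w_1:C_1\to C$, $w_2:C_2\to C$ and invertible 2-cells $\alpha:w_1v_1\Rightarrow w_2v_2$,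 $\beta:w_1u_1\Rightarrow w_2u_2$ such that $(\alpha y)\circ(w_1\xi_1)=(w_2\xi_2)\circ(\beta x)$ in $FC$. Two premorphisms are equivalent if there is a homotopy between them; this is an equivalence relation, and morphisms of $\mathcal{L}(F)$ are equivalence classes of premorphisms. The composite of the classes of $(u,\xi,v):(x,A)\to(y,B)$ and $(h,\zeta,k):(y,B)\to(z,C)$ is the class of $(su,\ (t\zeta)\circ(\gamma y)\circ(s\xi),\ tk)$, for any arrows $s,t$ with common codomain and any invertible 2-cell $\gamma:sv\Rightarrow th$ (these exist by F1, and the class is independent of choices). The identity of $(x,A)$ is the class of $(\mathrm{id}_A,\mathrm{id}_x,\mathrm{id}_A)$. Pseudocones: a pseudocone $h:F\Rightarrow\mathcal{X}$ with vertex the category $\mathcal{X}$ consists of functors $h_A:FA\to\mathcal{X}$ and natural isomorphisms $h_u:h_B\circ F(u)\to h_A$ (for $u:A\to B$) such that $h_{\mathrm{id}_A}=\mathrm{id}$, $h_{vu}=h_u\circ(h_vF(u))$, and $h_v\circ(h_BF(\gamma))=h_u$ for every 2-cell $\gamma:u\Rightarrow v:A\to B$. There is a pseudocone $\lambda:F\Rightarrow\mathcal{L}(F)$ given by $\lambda_A(x)=(x,A)$, $\lambda_A(\xi)=[(\mathrm{id}_A,\xi,\mathrm{id}_A)]$, $\lambda_u(x)=[(\mathrm{id}_B,\mathrm{id}_{ux},u)]:(ux,B)\to(x,A)$, and it is universal: for each pseudocone $h:F\Rightarrow\mathcal{X}$ there is a unique functor $\tilde h:\mathcal{L}(F)\to\mathcal{X}$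 with $\tilde h\lambda=h$ (on premorphisms, $\tilde h(x,A)=h_A(x)$ and $\tilde h[(u,\xi,v)]=(h_v)_y\circ h_C(\xi)\circ (h_u)_x^{-1}$). The canonical functor $\Diamond$ is the unique functor obtained from this universal property applied to the 2-functor $F^{\mathcal{P}}$ and to the pseudocone $F^{\mathcal{P}}\Rightarrow\mathcal{L}(F)^{\mathcal{P}}$ with components $(\lambda_A)^{\mathcal{P}}:(FA)^{\mathcal{P}}\to\mathcal{L}(F)^{\mathcal{P}}$ and $(\lambda_u)^{\mathcal{P}}$, given by post-composition with $\lambda_A$ and $\lambda_u$. *)

(* Defs.v *)
From Corelib Require Import ssreflect.
From Stdlib Require Import FunctionalExtensionality PropExtensionality.
From Stdlib Require Import ProofIrrelevance IndefiniteDescription.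
From Stdlib Require Import List FinFun Relations.

Set Implicit Arguments.
Unset Strict Implicit.
Unset Printing Implicit Defensive.

Record Category : Type := MkCategory {
  Ob :> Type;
  Hom : Ob -> Ob -> Type;
  idm : forall a, Hom a a;
  comp : forall a b c, Hom b c -> Hom a b -> Hom a c;
  comp_assoc : forall a b c d (h : Hom c d) (g : Hom b c) (f : Hom a b),
    comp h (comp g f) = comp (comp h g) f;
  comp_idl : forall a b (f : Hom a b), comp (idm b) f = f;
  comp_idr : forall a b (f : Hom a b), comp f (idm a) = f }.
Arguments idm {c} a : rename.

Notation "g ∘ f" := (comp g f) (at level 40, left associativity).

Definition isIso (C : Category) (a b : C) (f : Hom a b) : Prop :=
  exists g : Hom b a, g ∘ f = idm a /\ f ∘ g = idm b.

Record Functor (C D : Category) : Type := MkFunctor {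
  fob :> C -> D;
  fmap : forall a b, Hom a b -> Hom (fob a) (fob b);
  fmap_id : forall a, fmap (idm a) = idm (fob a);
  fmap_comp : forall a b c (g : Hom b c) (f : Hom a b),
    fmap (g ∘ f) = fmap g ∘ fmap f }.

Record NatTrans (C D : Category) (G H : Functor C D) : Type := MkNatTrans {
  component :> forall a, Hom (G a) (H a);
  naturality : forall a b (f : Hom a b),
    component b ∘ fmap G f = fmap H f ∘ component a }.

Lemma nat_ext (C D : Category) (G H : Functor C D) (s t : NatTrans G H) :
  (forall a, s a = t a) -> s = t.
Proof.
case: s t => s ns [t nt] /= e.
have {}e : s = t by apply: functional_extensionality_dep.
subst t; f_equal; exact: proof_irrelevance.
Qed.

Lemma idN_nat (C D : Category) (G : Functor C D) a b (f : Hom a b) :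
  idm (G b) ∘ fmap G f = fmap G f ∘ idm (G a).
Proof. by rewrite comp_idl comp_idr. Qed.

Definition idN (C D : Category) (G : Functor C D) : NatTrans G G :=
  MkNatTrans (@idN_nat C D G).

Lemma compN_nat (C D : Category) (G H K : Functor C D) (t : NatTrans H K)
    (s : NatTrans G H) a b (f : Hom a b) :
  (t b ∘ s b) ∘ fmap G f = fmap K f ∘ (t a ∘ s a).
Proof. by rewrite -comp_assoc naturality !comp_assoc naturality. Qed.

Definition compN (C D : Category) (G H K : Functor C D) (t : NatTrans H K)
    (s : NatTrans G H) : NatTrans G K :=
  MkNatTrans (compN_nat t s).

(* The functor category usually written D^C. *)
Definition FunCat (C D : Category) : Category.
Proof.
refine (@MkCategory (Functor C D) (@NatTrans C D) (@idN C D) (@compN C D) _ _ _).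
- by move=> a b c d h g f; apply: nat_ext => x /=; apply: comp_assoc.
- by move=> a b f; apply: nat_ext => x /=; apply: comp_idl.
- by move=> a b f; apply: nat_ext => x /=; apply: comp_idr.
Defined.

Definition idF (C : Category) : Functor C C :=
  @MkFunctor C C (fun a => a) (fun _ _ f => f)
    (fun _ => eq_refl) (fun _ _ _ _ _ => eq_refl).

Definition compF (C D E : Category) (G : Functor D E) (F : Functor C D) :
  Functor C E.
Proof.
refine (@MkFunctor C E (fun a => G (F a)) (fun _ _ f => fmap G (fmap F f)) _ _).
- by move=> a; rewrite !fmap_id.
- by move=> a b c g f; rewrite !fmap_comp.
Defined.

Definition hcompN (C D E : Category) (G G' : Functor D E) (F F' : Functor C D)
    (t : NatTrans G G') (s : NatTrans F F') : NatTrans (compF G F) (compF G' F').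
Proof.
refine (@MkNatTrans C E (compF G F) (compF G' F')
          (fun a => t (F' a) ∘ fmap G (s a)) _).
move=> a b f /=.
by rewrite -comp_assoc -fmap_comp (naturality s) fmap_comp !comp_assoc naturality.
Defined.

Definition is_equivalence (C D : Category) (G : Functor C D) : Prop :=
  exists (K : Functor D C)
         (eta : Hom (idF C : FunCat C C) (compF K G))
         (eps : Hom (compF G K : FunCat D D) (idF D)),
    isIso eta /\ isIso eps.

Definition finite_category (P : Category) : Prop :=
  Finite P /\ forall a b : P, Finite (Hom a b).

Definition connected_category (P : Category) : Prop :=
  inhabited P /\
  forall a b : P, clos_refl_sym_trans P (fun x y => inhabited (Hom x y)) a b.

(* The equations of strict 2-category theory compare morphisms whose endpoints
   are only propositionally equal.  [f ≡ g] means that f and g have equal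
   endpoints and are equal; [castH e1 e2 f] is f with its endpoints replaced by
   equal ones, and [idh e] is the identity as a morphism between two equal
   objects. *)
Inductive HomEq (C : Category) (a b : C) (f : Hom a b) :
  forall a' b' : C, Hom a' b' -> Prop := HomEq_refl : HomEq f f.
Notation "f ≡ g" := (HomEq f g) (at level 70, no associativity).

Definition idh (C : Category) (a b : C) (e : a = b) : Hom a b :=
  match e in _ = b' return Hom a b' with eq_refl => idm a end.

Definition castH (C : Category) (a b a' b' : C) (e1 : a = a') (e2 : b = b')
    (f : Hom a b) : Hom a' b' :=
  match e1 in _ = x, e2 in _ = y return Hom x y with
  | eq_refl, eq_refl => f
  end.

(* [pk f] is f with its endpoints forgotten, and [mul] is composition of such
   untyped arrows, so that f ≡ g iff pk f = pk g. *)
Record Arr (C : Category) : Type :=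
  Pack { asrc : C; atgt : C; aarr : Hom asrc atgt }.
Definition pk (C : Category) (a b : C) (f : Hom a b) : Arr C -> Prop :=
  eq (Pack f).
Definition mul (C : Category) (Q R : Arr C -> Prop) : Arr C -> Prop :=
  fun h => exists a b c (g : Hom b c) (f : Hom a b),
    Q (Pack g) /\ R (Pack f) /\ h = Pack (g ∘ f).

Lemma pack_inj (C : Category) (a b : C) (f g : Hom a b) :
  Pack f = Pack g -> f = g.
Proof.
move=> e.
have H : forall (p q : Arr C) (e : p = q) (e1 : asrc p = asrc q)
    (e2 : atgt p = atgt q),
  eq_rect _ (fun y => Hom (asrc q) y)
    (eq_rect _ (fun x => Hom x (atgt p)) (aarr p) _ e1) _ e2 = aarr q.
  move=> p q <- e1 e2.
  by rewrite (proof_irrelevance _ e1 eq_refl) (proof_irrelevance _ e2 eq_refl).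
exact: (H _ _ e eq_refl eq_refl).
Qed.

Lemma pk_inj (C : Category) (a b : C) (f g : Hom a b) : pk f = pk g -> f = g.
Proof.
move=> e; apply: pack_inj.
have : pk g (Pack g) by [].
by rewrite -e.
Qed.

Lemma pk_heq (C : Category) (a b a' b' : C) (f : Hom a b) (g : Hom a' b') :
  pk f = pk g -> f ≡ g.
Proof.
move=> e.
have : pk g (Pack g) by [].
rewrite -e /pk => {}e.
have H : forall p q : Arr C, p = q -> aarr p ≡ aarr q by move=> p q <-.
exact: (H _ _ e).
Qed.

Lemma heq_pk (C : Category) (a b a' b' : C) (f : Hom a b) (g : Hom a' b') :
  f ≡ g -> pk f = pk g.
Proof. by case. Qed.

Lemma pk_comp (C : Category) (a b c : C) (g : Hom b c) (f : Hom a b) :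
  pk (g ∘ f) = mul (pk g) (pk f).
Proof.
apply: functional_extensionality => h; apply: propositional_extensionality.
split.
- by move=> <-; exists a, b, c, g, f.
- case=> a' [b' [c' [g' [f' [e1 [e2 ->]]]]]].
  move: (f_equal (@atgt C) e2) (f_equal (@asrc C) e2) (f_equal (@atgt C) e1).
  move=> /= ? ? ?; subst a' b' c'.
  by rewrite (pack_inj e1) (pack_inj e2).
Qed.

Lemma mulA (C : Category) (Q R S : Arr C -> Prop) :
  mul Q (mul R S) = mul (mul Q R) S.
Proof.
apply: functional_extensionality => k; apply: propositional_extensionality.
split.
- case=> a [b [c [h [x [qh [[a' [b' [c' [g [f [rg [sf e]]]]]]] ->]]]]]].
  move: (f_equal (@atgt C) e) (f_equal (@asrc C) e) => /= ? ?; subst b a.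
  rewrite (pack_inj e).
  exists a', b', c, (h ∘ g), f; rewrite comp_assoc; split=> //.
  by exists b', c', c, h, g.
- case=> a [b [c [x [f [[a' [b' [c' [h [g [qh [rg e]]]]]]] [sf ->]]]]]].
  move: (f_equal (@atgt C) e) (f_equal (@asrc C) e) => /= ? ?; subst b c.
  rewrite (pack_inj e).
  exists a, b', c', h, (g ∘ f); rewrite comp_assoc; split=> //.
  by split=> //; exists a, a', b', g, f.
Qed.

Lemma pk_idhl (C : Category) (a b c : C) (e : b = c) (f : Hom a b) :
  pk (idh e ∘ f) = pk f.
Proof. by case: c / e; rewrite comp_idl. Qed.

Lemma pk_idhr (C : Category) (a b c : C) (e : a = b) (f : Hom b c) :
  pk (f ∘ idh e) = pk f.
Proof. by subst b; rewrite comp_idr. Qed.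

Lemma pk_idh (C : Category) (a b : C) (e : a = b) : pk (idh e) = pk (idm a).
Proof. by subst b. Qed.

Lemma pk_castH (C : Category) (a b a' b' : C) (e1 : a = a') (e2 : b = b')
  (f : Hom a b) : pk (castH e1 e2 f) = pk f.
Proof. by subst. Qed.

Definition pkE := (pk_castH, pk_idhl, pk_idhr, pk_comp).

Lemma fmap_idh (C D : Category) (G : Functor C D) (a b : C) (e : a = b) :
  fmap G (idh e) = idh (f_equal G e).
Proof. by subst b; rewrite /= fmap_id. Qed.

Lemma fmap_castH (C D : Category) (G : Functor C D) (a b a' b' : C)
    (e1 : a = a') (e2 : b = b') (f : Hom a b) :
  fmap G (castH e1 e2 f) = castH (f_equal G e1) (f_equal G e2) (fmap G f).
Proof. by subst. Qed.

Lemma pk_fmap (C D : Category) (G G' : Functor C D) (a b a' b' : C)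
    (f : Hom a b) (g : Hom a' b') :
  G = G' -> pk f = pk g -> pk (fmap G f) = pk (fmap G' g).
Proof. by move=> <- /pk_heq; case. Qed.

Lemma pk_nat (C D : Category) (G H G' H' : Functor C D) (s : NatTrans G H)
    (t : NatTrans G' H') (a : C) :
  @HomEq (FunCat C D) G H s G' H' t -> pk (s a) = pk (t a).
Proof. by case. Qed.

Lemma functor_ext (C D : Category) (G H : Functor C D) :
  (forall a, G a = H a) ->
  (forall a b (f : Hom a b), fmap G f ≡ fmap H f) -> G = H.
Proof.
case: G H => G G1 Gi Gc [H H1 Hi Hc] /= e.
have {}e : G = H by apply: functional_extensionality.
subst H => e.
have {}e : G1 = H1.
  do 3! apply: functional_extensionality_dep => ?.
  exact/pk_inj/heq_pk/e.
by subst H1; f_equal; apply: proof_irrelevance.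
Qed.

Lemma nat_heq (C D : Category) (G H G' H' : Functor C D) (s : NatTrans G H)
    (t : NatTrans G' H') :
  G = G' -> H = H' -> (forall a, pk (s a) = pk (t a)) ->
  @HomEq (FunCat C D) G H s G' H' t.
Proof.
move=> ? ?; subst G' H' => e.
have -> : s = t by apply: nat_ext => a; apply: pk_inj.
by [].
Qed.

Lemma iso_id (C : Category) (a : C) : isIso (idm a).
Proof. by exists (idm a); rewrite comp_idl. Qed.

Lemma iso_idh (C : Category) (a b : C) (e : a = b) : isIso (idh e).
Proof. by subst b; apply: iso_id. Qed.

Lemma iso_castH (C : Category) (a b a' b' : C) (e1 : a = a') (e2 : b = b')
  (f : Hom a b) : isIso f -> isIso (castH e1 e2 f).
Proof. by subst. Qed.

Lemma iso_comp (C : Category) (a b c : C) (g : Hom b c) (f : Hom a b) :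
  isIso g -> isIso f -> isIso (g ∘ f).
Proof.
case=> g' [gl gr] [f' [fl fr]]; exists (f' ∘ g'); split.
- by rewrite -comp_assoc [g' ∘ _]comp_assoc gl comp_idl.
- by rewrite -comp_assoc [f ∘ (_ ∘ _)]comp_assoc fr comp_idl.
Qed.

Lemma iso_fmap (C D : Category) (G : Functor C D) (a b : C) (f : Hom a b) :
  isIso f -> isIso (fmap G f).
Proof.
by case=> g [gl gr]; exists (fmap G g); rewrite -!fmap_comp gl gr !fmap_id.
Qed.

Lemma iso_epi (C : Category) (a b c : C) (e : Hom a b) (f g : Hom b c) :
  isIso e -> f ∘ e = g ∘ e -> f = g.
Proof.
case=> e' [_ er] E.
by rewrite -(comp_idr f) -(comp_idr g) -er !comp_assoc E.
Qed.

Lemma iso_component (C D : Category) (G H : FunCat C D) (s : Hom G H) a :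
  isIso s -> isIso (component s a).
Proof.
case=> t [tl tr]; exists (component t a).
by split; [have := f_equal (fun r => component r a) tl
          |have := f_equal (fun r => component r a) tr].
Qed.

Lemma nat_iso (C D : Category) (G H : FunCat C D) (s : Hom G H) :
  (forall a, isIso (component s a)) -> isIso s.
Proof.
move=> i.
pose t a := proj1_sig (constructive_indefinite_description _ (i a)).
have tP a : t a ∘ component s a = idm _ /\ component s a ∘ t a = idm _.
  by rewrite /t; case: constructive_indefinite_description.
have tn : forall a b (f : Hom a b), t b ∘ fmap H f = fmap G f ∘ t a.
  move=> a b f; apply: (iso_epi (i a)).
  rewrite -!comp_assoc (proj1 (tP a)) comp_idr -naturality comp_assoc.
  by rewrite (proj1 (tP b)) comp_idl.
by exists (MkNatTrans tn : Hom H G); split; apply: nat_ext => a /=; apply tP.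
Qed.

Definition inv (C : Category) (a b : C) (f : Hom a b) (i : isIso f) : Hom b a :=
  proj1_sig (constructive_indefinite_description _ i).

Lemma inv_l (C : Category) (a b : C) (f : Hom a b) (i : isIso f) :
  inv i ∘ f = idm a.
Proof. by rewrite /inv; case: constructive_indefinite_description => g []. Qed.

Lemma inv_r (C : Category) (a b : C) (f : Hom a b) (i : isIso f) :
  f ∘ inv i = idm b.
Proof. by rewrite /inv; case: constructive_indefinite_description => g []. Qed.

Lemma iso_inv (C : Category) (a b : C) (f : Hom a b) (i : isIso f) :
  isIso (inv i).
Proof. by exists f; rewrite inv_l inv_r. Qed.

(* [Hom2 A B] has the arrows A → B as objects and the 2-cells as morphisms;
   [∘] is therefore the vertical composition of 2-cells. *)
Record TwoCat : Type := MkTwoCat {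
  Ob2 :> Type;
  Hom2 : Ob2 -> Ob2 -> Category;
  id1 : forall A, Hom2 A A;
  comp1 : forall A B C, Hom2 B C -> Hom2 A B -> Hom2 A C;
  comp2 : forall A B C (v v' : Hom2 B C) (u u' : Hom2 A B),
    Hom v v' -> Hom u u' -> Hom (comp1 v u) (comp1 v' u');
  comp2_id : forall A B C (v : Hom2 B C) (u : Hom2 A B),
    comp2 (idm v) (idm u) = idm (comp1 v u);
  interchange : forall A B C (v v' v'' : Hom2 B C) (u u' u'' : Hom2 A B)
      (b' : Hom v' v'') (b : Hom v v') (a' : Hom u' u'') (a : Hom u u'),
    comp2 (b' ∘ b) (a' ∘ a) = comp2 b' a' ∘ comp2 b a;
  assoc1 : forall A B C D (w : Hom2 C D) (v : Hom2 B C) (u : Hom2 A B),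
    comp1 w (comp1 v u) = comp1 (comp1 w v) u;
  assoc2 : forall A B C D (w w' : Hom2 C D) (v v' : Hom2 B C) (u u' : Hom2 A B)
      (c : Hom w w') (b : Hom v v') (a : Hom u u'),
    comp2 c (comp2 b a) ≡ comp2 (comp2 c b) a;
  idl1 : forall A B (u : Hom2 A B), comp1 (id1 B) u = u;
  idl2 : forall A B (u u' : Hom2 A B) (a : Hom u u'),
    comp2 (idm (id1 B)) a ≡ a;
  idr1 : forall A B (u : Hom2 A B), comp1 u (id1 A) = u;
  idr2 : forall A B (u u' : Hom2 A B) (a : Hom u u'),
    comp2 a (idm (id1 A)) ≡ a }.
Arguments id1 {t} A : rename.

Notation "v · u" := (comp1 v u) (at level 38, left associativity).
Notation "b ⋆ a" := (comp2 b a) (at level 38, left associativity).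
Notation "w ◁ a" := (comp2 (idm w) a) (at level 38, left associativity).
Notation "a ▷ g" := (comp2 a (idm g)) (at level 38, left associativity).

(* The whiskering w v g ⇒ w' v' g, bracketed to the right. *)
Definition whisk (A : TwoCat) (E B C C' D : A)
    (w : Hom2 C D) (v : Hom2 B C) (w' : Hom2 C' D) (v' : Hom2 B C')
    (a : Hom (w · v) (w' · v')) (g : Hom2 E B) :
    Hom (w · (v · g)) (w' · (v' · g)) :=
  castH (eq_sym (assoc1 w v g)) (eq_sym (assoc1 w' v' g)) (a ▷ g).

Definition axiom_F0 (A : TwoCat) : Prop :=
  forall X Y : A, exists Z : A, inhabited (Hom2 X Z) /\ inhabited (Hom2 Y Z).

Definition axiom_F1 (A : TwoCat) : Prop :=
  forall (E X Y : A) (f : Hom2 E X) (g : Hom2 E Y),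
  exists (Z : A) (u : Hom2 X Z) (v : Hom2 Y Z) (c : Hom (u · f) (v · g)),
    isIso c.

Definition axiom_FF1 (A : TwoCat) : Prop :=
  forall (E1 E2 X Y : A) (f1 : Hom2 E1 X) (g1 : Hom2 E1 Y)
    (f2 : Hom2 E2 X) (g2 : Hom2 E2 Y),
  exists (Z : A) (u : Hom2 X Z) (v : Hom2 Y Z)
    (c1 : Hom (u · f1) (v · g1)) (c2 : Hom (u · f2) (v · g2)),
    isIso c1 /\ isIso c2.

Definition axiom_F2 (A : TwoCat) : Prop :=
  forall (E X Y Z1 Z2 : A) (f : Hom2 E X) (g : Hom2 E Y)
    (u1 : Hom2 X Z1) (v1 : Hom2 Y Z1) (u2 : Hom2 X Z2) (v2 : Hom2 Y Z2)
    (c1 : Hom (u1 · f) (v1 · g)) (c2 : Hom (u2 · f) (v2 · g)),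
  exists (Z : A) (w1 : Hom2 Z1 Z) (w2 : Hom2 Z2 Z)
    (a : Hom (w1 · v1) (w2 · v2)) (b : Hom (w1 · u1) (w2 · u2)),
    isIso a /\ isIso b /\
    whisk a g ∘ (w1 ◁ c1) = (w2 ◁ c2) ∘ whisk b f.

Definition axiom_F3 (A : TwoCat) : Prop :=
  forall (E X Z1 Z2 : A) (f g : Hom2 E X)
    (u1 : Hom2 X Z1) (u2 : Hom2 X Z2)
    (c1 : Hom (u1 · f) (u1 · g)) (c2 : Hom (u2 · f) (u2 · g)),
  exists (Z : A) (w1 : Hom2 Z1 Z) (w2 : Hom2 Z2 Z)
    (e : Hom (w1 · u1) (w2 · u2)),
    isIso e /\
    whisk e g ∘ (w1 ◁ c1) = (w2 ◁ c2) ∘ whisk e f.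

Definition pre_two_filtered (A : TwoCat) : Prop := axiom_F1 A /\ axiom_F2 A.

Definition pseudo_two_filtered (A : TwoCat) : Prop :=
  axiom_FF1 A /\ axiom_F2 A /\ axiom_F3 A.

Definition two_filtered (A : TwoCat) : Prop :=
  pseudo_two_filtered A /\ inhabited A /\ axiom_F0 A.

Record TwoFunctor (A : TwoCat) : Type := MkTwoFunctor {
  Fobj :> A -> Category;
  Fhom : forall X Y : A, Functor (Hom2 X Y) (FunCat (Fobj X) (Fobj Y));
  Fhom_id : forall X : A, Fhom X X (id1 X) = idF (Fobj X);
  Fhom_comp : forall (X Y Z : A) (v : Hom2 Y Z) (u : Hom2 X Y),
    Fhom X Z (v · u) = compF (Fhom Y Z v) (Fhom X Y u);
  Fhom_comp2 : forall (X Y Z : A) (v v' : Hom2 Y Z) (u u' : Hom2 X Y)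
      (b : Hom v v') (a : Hom u u'),
    @HomEq (FunCat (Fobj X) (Fobj Z)) _ _ (fmap (Fhom X Z) (b ⋆ a))
      (compF (Fhom Y Z v) (Fhom X Y u)) (compF (Fhom Y Z v') (Fhom X Y u'))
      (hcompN (fmap (Fhom Y Z) b) (fmap (Fhom X Y) a)) }.

Definition Farr (A : TwoCat) (F : TwoFunctor A) (X Y : A) (u : Hom2 X Y) :
  Functor (F X) (F Y) := Fhom F X Y u.

Definition Fcell (A : TwoCat) (F : TwoFunctor A) (X Y : A) (u v : Hom2 X Y)
  (a : Hom u v) : NatTrans (Farr F u) (Farr F v) := fmap (Fhom F X Y) a.

Section TwoFunctorLemmas.
Variables (A : TwoCat) (F : TwoFunctor A).

Lemma Farr_id (X : A) : Farr F (id1 X) = idF (F X).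
Proof. exact: Fhom_id. Qed.

Lemma Farr_comp (X Y Z : A) (v : Hom2 Y Z) (u : Hom2 X Y) :
  Farr F (v · u) = compF (Farr F v) (Farr F u).
Proof. exact: Fhom_comp. Qed.

Lemma Farr_id_ob (X : A) x : Farr F (id1 X) x = x.
Proof. by rewrite Farr_id. Qed.

Lemma Farr_comp_ob (X Y Z : A) (v : Hom2 Y Z) (u : Hom2 X Y) x :
  Farr F (v · u) x = Farr F v (Farr F u x).
Proof. by rewrite Farr_comp. Qed.

Lemma pk_Farr_id (X : A) x y (f : Hom x y) : pk (fmap (Farr F (id1 X)) f) = pk f.
Proof. by rewrite Farr_id. Qed.

Lemma pk_Farr_comp (X Y Z : A) (v : Hom2 Y Z) (u : Hom2 X Y) x y (f : Hom x y) :
  pk (fmap (Farr F (v · u)) f) = pk (fmap (Farr F v) (fmap (Farr F u) f)).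
Proof. by rewrite Farr_comp. Qed.

Lemma Fcell_id (X Y : A) (u : Hom2 X Y) x : Fcell F (idm u) x = idm (Farr F u x).
Proof. by rewrite /Fcell fmap_id. Qed.

Lemma Fcell_comp (X Y : A) (u v w : Hom2 X Y) (b : Hom v w) (a : Hom u v) x :
  Fcell F (b ∘ a) x = Fcell F b x ∘ Fcell F a x.
Proof. by rewrite /Fcell fmap_comp. Qed.

Lemma Fcell_idh (X Y : A) (u v : Hom2 X Y) (e : u = v) x :
  Fcell F (idh e) x = idh (f_equal (fun u => Farr F u x) e).
Proof. by subst v; rewrite /= Fcell_id. Qed.

Lemma Fcell_castH (X Y : A) (u v u' v' : Hom2 X Y) (e1 : u = u') (e2 : v = v')
    (a : Hom u v) x :
  pk (Fcell F (castH e1 e2 a) x) = pk (Fcell F a x).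
Proof. by subst. Qed.

Lemma Fcell_wl (X Y Z : A) (w : Hom2 Y Z) (u v : Hom2 X Y) (a : Hom u v) x :
  pk (Fcell F (w ◁ a) x) = pk (fmap (Farr F w) (Fcell F a x)).
Proof.
rewrite /Fcell (pk_nat x (Fhom_comp2 F (idm w) a)) /=.
by rewrite fmap_id /= comp_idl.
Qed.

Lemma Fcell_wr (X Y Z : A) (w w' : Hom2 Y Z) (a : Hom w w') (u : Hom2 X Y) x :
  pk (Fcell F (a ▷ u) x) = pk (Fcell F a (Farr F u x)).
Proof.
rewrite /Fcell (pk_nat x (Fhom_comp2 F a (idm u))) /=.
by rewrite fmap_id /= fmap_id comp_idr.
Qed.

Lemma Fcell_iso (X Y : A) (u v : Hom2 X Y) (a : Hom u v) x :
  isIso a -> isIso (Fcell F a x).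
Proof. by move=> i; apply: iso_component; apply: iso_fmap. Qed.

(* The component α_x of α : w v ⇒ w' v', read as a morphism
   w(v x) → w'(v' x). *)
Definition act (X C C' D : A) (w : Hom2 C D) (v : Hom2 X C)
    (w' : Hom2 C' D) (v' : Hom2 X C') (a : Hom (w · v) (w' · v')) (x : F X) :
    Hom (Farr F w (Farr F v x)) (Farr F w' (Farr F v' x)) :=
  castH (Farr_comp_ob w v x) (Farr_comp_ob w' v' x) (Fcell F a x).

Lemma pk_act (X C C' D : A) (w : Hom2 C D) (v : Hom2 X C)
    (w' : Hom2 C' D) (v' : Hom2 X C') (a : Hom (w · v) (w' · v')) (x : F X) :
  pk (act a x) = pk (Fcell F a x).
Proof. by rewrite /act pk_castH. Qed.

Lemma act_iso (X C C' D : A) (w : Hom2 C D) (v : Hom2 X C)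
    (w' : Hom2 C' D) (v' : Hom2 X C') (a : Hom (w · v) (w' · v')) (x : F X) :
  isIso a -> isIso (act a x).
Proof. by move=> i; apply: iso_castH; apply: Fcell_iso. Qed.

End TwoFunctorLemmas.
Arguments act {A} F {X C C' D w v w' v'} a x.

Lemma wl_iso (A : TwoCat) (X Y Z : A) (w : Hom2 Y Z) (u v : Hom2 X Y)
  (a : Hom u v) : isIso a -> isIso (w ◁ a).
Proof.
case=> a' [l r]; exists (w ◁ a').
by rewrite -!interchange l r !comp_idl !comp2_id.
Qed.

Lemma wr_iso (A : TwoCat) (X Y Z : A) (w w' : Hom2 Y Z) (a : Hom w w')
  (u : Hom2 X Y) : isIso a -> isIso (a ▷ u).
Proof.
case=> a' [l r]; exists (a' ▷ u).
by rewrite -!interchange l r !comp_idl !comp2_id.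
Qed.

Lemma whisk_iso (A : TwoCat) (E B C C' D : A)
    (w : Hom2 C D) (v : Hom2 B C) (w' : Hom2 C' D) (v' : Hom2 B C')
    (a : Hom (w · v) (w' · v')) (g : Hom2 E B) :
  isIso a -> isIso (whisk a g).
Proof. by move=> i; apply: iso_castH; apply: wr_iso. Qed.

Lemma pk_whisk (A : TwoCat) (F : TwoFunctor A) (E B C C' D : A)
    (w : Hom2 C D) (v : Hom2 B C) (w' : Hom2 C' D) (v' : Hom2 B C')
    (a : Hom (w · v) (w' · v')) (g : Hom2 E B) x :
  pk (Fcell F (whisk a g) x) = pk (Fcell F a (Farr F g x)).
Proof. by rewrite /whisk Fcell_castH Fcell_wr. Qed.

Lemma pk_fmap_act (A : TwoCat) (F : TwoFunctor A) (X C C' D E : A)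
    (w : Hom2 C D) (v : Hom2 X C) (w' : Hom2 C' D) (v' : Hom2 X C')
    (a : Hom (w · v) (w' · v')) (x : F X) (s : Hom2 D E) :
  pk (fmap (Farr F s) (act F a x)) = pk (fmap (Farr F s) (Fcell F a x)).
Proof. by rewrite /act fmap_castH pk_castH. Qed.

Record LOb (A : TwoCat) (F : TwoFunctor A) : Type := MkLOb {
  base : A;
  pt : F base }.

Record PreMor (A : TwoCat) (F : TwoFunctor A) (X Y : LOb F) : Type := MkPreMor {
  pC : A;
  pu : Hom2 (base X) pC;
  pv : Hom2 (base Y) pC;
  pxi : Hom (Farr F pu (pt X)) (Farr F pv (pt Y)) }.

Definition homotopic (A : TwoCat) (F : TwoFunctor A) (X Y : LOb F)
    (p q : PreMor X Y) : Prop :=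
  exists (D : A) (w1 : Hom2 (pC p) D) (w2 : Hom2 (pC q) D)
    (a : Hom (w1 · pv p) (w2 · pv q)) (b : Hom (w1 · pu p) (w2 · pu q)),
    isIso a /\ isIso b /\
    act F a (pt Y) ∘ fmap (Farr F w1) (pxi p) =
    fmap (Farr F w2) (pxi q) ∘ act F b (pt X).

(* Morphisms of L(F) are equivalence classes, i.e. predicates of the form
   [homotopic p]. *)
Definition LHom (A : TwoCat) (F : TwoFunctor A) (X Y : LOb F) : Type :=
  {c : PreMor X Y -> Prop | exists p, c = homotopic p}.

Definition cls (A : TwoCat) (F : TwoFunctor A) (X Y : LOb F) (p : PreMor X Y) :
  LHom X Y := exist _ (homotopic p) (ex_intro _ p eq_refl).

Definition pre_id (A : TwoCat) (F : TwoFunctor A) (X : LOb F) : PreMor X X :=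
  MkPreMor (idm (Farr F (id1 (base X)) (pt X))).

(* For p = (u,ξ,v) and q = (h,ζ,k): the composite (su, (tζ)∘(γy)∘(sξ), tk). *)
Definition pre_comp (A : TwoCat) (F : TwoFunctor A) (X Y Z : LOb F)
    (q : PreMor Y Z) (p : PreMor X Y) (D : A)
    (s : Hom2 (pC p) D) (t : Hom2 (pC q) D) (c : Hom (s · pv p) (t · pu q)) :
    PreMor X Z :=
  @MkPreMor A F X Z D (s · pu p) (t · pv q)
    (castH (eq_sym (Farr_comp_ob s (pu p) (pt X)))
       (eq_sym (Farr_comp_ob t (pv q) (pt Z)))
       (fmap (Farr F t) (pxi q) ∘ act F c (pt Y) ∘ fmap (Farr F s) (pxi p))).

Lemma homotopicI (A : TwoCat) (F : TwoFunctor A) (X Y : LOb F)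
    (p q : PreMor X Y) (D : A) (w1 : Hom2 (pC p) D) (w2 : Hom2 (pC q) D)
    (a : Hom (w1 · pv p) (w2 · pv q)) (b : Hom (w1 · pu p) (w2 · pu q)) :
  isIso a -> isIso b ->
  mul (pk (Fcell F a (pt Y))) (pk (fmap (Farr F w1) (pxi p))) =
  mul (pk (fmap (Farr F w2) (pxi q))) (pk (Fcell F b (pt X))) ->
  homotopic p q.
Proof.
move=> ia ib e; exists D, w1, w2, a, b; split=> //; split=> //.
by apply: pk_inj; rewrite !(pk_act, pk_comp).
Qed.

Lemma homotopic_refl (A : TwoCat) (F : TwoFunctor A) (X Y : LOb F)
  (p : PreMor X Y) : homotopic p p.
Proof.
apply: (@homotopicI _ _ _ _ _ _ _ (id1 _) (id1 _) (idm _) (idm _));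
  try exact: iso_id.
rewrite !Fcell_id !Farr_comp_ob -!pk_comp.
by rewrite comp_idl comp_idr.
Qed.

Lemma homotopic_sym (A : TwoCat) (F : TwoFunctor A) (X Y : LOb F)
  (p q : PreMor X Y) : homotopic p q -> homotopic q p.
Proof.
case=> D [w1 [w2 [a [b [ia [ib e]]]]]].
case: (ia) (ib) => a' [al ar] [b' [bl br]].
apply: (@homotopicI _ _ _ _ _ _ D w2 w1 a' b'); [by exists a|by exists b|].
have ca : act F a' (pt Y) ∘ act F a (pt Y) = idm _.
  apply: pk_inj; rewrite !(pk_act, pk_comp) -pk_comp -Fcell_comp al Fcell_id.
  by rewrite Farr_comp_ob.
have cb : act F b (pt X) ∘ act F b' (pt X) = idm _.
  apply: pk_inj; rewrite !(pk_act, pk_comp) -pk_comp -Fcell_comp br Fcell_id.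
  by rewrite Farr_comp_ob.
have {}e : act F a' (pt Y) ∘ fmap (Farr F w2) (pxi q) =
    fmap (Farr F w1) (pxi p) ∘ act F b' (pt X).
  rewrite -[fmap _ (pxi q)]comp_idr -cb [fmap _ _ ∘ _]comp_assoc -e.
  by rewrite !comp_assoc ca comp_idl.
by move: (f_equal (fun f => pk f) e); rewrite !(pk_act, pk_comp).
Qed.

Definition glue (A : TwoCat) (B C1 C2 C3 D1 D2 D : A)
    (w1 : Hom2 C1 D1) (w2 : Hom2 C2 D1) (w2' : Hom2 C2 D2) (w3 : Hom2 C3 D2)
    (v1 : Hom2 B C1) (v2 : Hom2 B C2) (v3 : Hom2 B C3)
    (s : Hom2 D1 D) (t : Hom2 D2 D) (c : Hom (s · w2) (t · w2'))
    (a : Hom (w1 · v1) (w2 · v2)) (a' : Hom (w2' · v2) (w3 · v3)) :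
    Hom ((s · w1) · v1) ((t · w3) · v3) :=
  castH (assoc1 s w1 v1) (assoc1 t w3 v3)
    ((t ◁ a') ∘ (whisk c v2 ∘ (s ◁ a))).

Lemma glue_iso (A : TwoCat) (B C1 C2 C3 D1 D2 D : A)
    (w1 : Hom2 C1 D1) (w2 : Hom2 C2 D1) (w2' : Hom2 C2 D2) (w3 : Hom2 C3 D2)
    (v1 : Hom2 B C1) (v2 : Hom2 B C2) (v3 : Hom2 B C3)
    (s : Hom2 D1 D) (t : Hom2 D2 D) (c : Hom (s · w2) (t · w2'))
    (a : Hom (w1 · v1) (w2 · v2)) (a' : Hom (w2' · v2) (w3 · v3)) :
  isIso c -> isIso a -> isIso a' -> isIso (glue c a a').
Proof.
move=> ic ia ia'.
apply: iso_castH.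
repeat first [exact: wl_iso | exact: whisk_iso | apply: iso_comp].
Qed.

Lemma pk_glue (A : TwoCat) (F : TwoFunctor A) (B C1 C2 C3 D1 D2 D : A)
    (w1 : Hom2 C1 D1) (w2 : Hom2 C2 D1) (w2' : Hom2 C2 D2) (w3 : Hom2 C3 D2)
    (v1 : Hom2 B C1) (v2 : Hom2 B C2) (v3 : Hom2 B C3)
    (s : Hom2 D1 D) (t : Hom2 D2 D) (c : Hom (s · w2) (t · w2'))
    (a : Hom (w1 · v1) (w2 · v2)) (a' : Hom (w2' · v2) (w3 · v3)) x :
  pk (Fcell F (glue c a a') x) =
  mul (pk (fmap (Farr F t) (Fcell F a' x)))
    (mul (pk (Fcell F c (Farr F v2 x))) (pk (fmap (Farr F s) (Fcell F a x)))).
Proof.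
by rewrite /glue Fcell_castH !Fcell_comp !pk_comp pk_whisk !Fcell_wl.
Qed.

Lemma homotopic_trans (A : TwoCat) (hA : pre_two_filtered A) (F : TwoFunctor A)
    (X Y : LOb F) (p q r : PreMor X Y) :
  homotopic p q -> homotopic q r -> homotopic p r.
Proof.
case=> D1 [w1 [w2 [a [b [ia [ib e]]]]]].
case=> D2 [w2' [w3 [a' [b' [ia' [ib' e']]]]]].
case: (proj1 hA _ _ _ w2 w2') => D [s [t [c ic]]].
apply: (@homotopicI _ _ _ _ _ _ D (s · w1) (t · w3)
         (glue c a a') (glue c b b')); try exact: glue_iso.
rewrite !pk_glue !pk_Farr_comp.
move: (f_equal (fun f => pk (fmap (Farr F s) f)) e).
rewrite !fmap_comp !(pk_fmap_act, pk_comp) => {}e.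
move: (f_equal (fun f => pk (fmap (Farr F t) f)) e').
rewrite !fmap_comp !(pk_fmap_act, pk_comp) => {}e'.
have n := f_equal (fun f => pk f) (naturality (Fcell F c) (pxi q)).
move: n; rewrite /= !pk_comp !pk_Farr_comp => n.
by rewrite -!mulA e [mul (pk (Fcell F c _)) _]mulA n !mulA e'.
Qed.

Lemma cls_eq (A : TwoCat) (hA : pre_two_filtered A) (F : TwoFunctor A)
    (X Y : LOb F) (p q : PreMor X Y) : homotopic p q -> cls p = cls q.
Proof.
move=> h; apply: eq_sig_hprop => [? ? ?|/=]; first exact: proof_irrelevance.
apply: functional_extensionality => r; apply: propositional_extensionality.
split; apply: homotopic_trans => //; exact: homotopic_sym.
Qed.

Lemma cls_homotopic (A : TwoCat) (F : TwoFunctor A)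
    (X Y : LOb F) (p q : PreMor X Y) : cls p = cls q -> homotopic p q.
Proof.
move/(f_equal (@proj1_sig _ _)) => /= ->; exact: homotopic_refl.
Qed.

Lemma cls_surj (A : TwoCat) (F : TwoFunctor A) (X Y : LOb F) (c : LHom X Y) :
  exists p, c = cls p.
Proof.
case: c => c [p e]; exists p.
by apply: eq_sig_hprop => // ? ? ?; apply: proof_irrelevance.
Qed.

Definition pkFE := (pk_castH, pk_act, pk_fmap_act, fmap_castH, Fcell_castH,
  Fcell_wl, pk_Farr_id, pk_Farr_comp, fmap_comp, pk_comp).

Lemma pre_eq (A : TwoCat) (F : TwoFunctor A) (X Y : LOb F) (C : A)
    (u u' : Hom2 (base X) C) (v v' : Hom2 (base Y) C)
    (xi : Hom (Farr F u (pt X)) (Farr F v (pt Y)))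
    (xi' : Hom (Farr F u' (pt X)) (Farr F v' (pt Y))) :
  u = u' -> v = v' -> pk xi = pk xi' ->
  @MkPreMor A F X Y C u v xi = @MkPreMor A F X Y C u' v' xi'.
Proof. by move=> ? ? e; subst; rewrite (pk_inj e). Qed.

Lemma pk_act_idhl (A : TwoCat) (F : TwoFunctor A) (X C C' D : A)
    (w : Hom2 C D) (v : Hom2 X C) (w' : Hom2 C' D) (v' : Hom2 X C')
    (e : w · v = w' · v') (x : F X) z (f : Hom z _) :
  pk (act F (idh e) x ∘ f) = pk f.
Proof.
have -> : act F (idh e) x = idh (eq_trans (eq_sym (Farr_comp_ob w v x))
    (eq_trans (f_equal (fun u => Farr F u x) e) (Farr_comp_ob w' v' x))).
  apply: pk_inj; rewrite pk_act Fcell_idh !pk_idh.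
  by rewrite Farr_comp_ob.
exact: pk_idhl.
Qed.

Lemma pk_act_idhr (A : TwoCat) (F : TwoFunctor A) (X C C' D : A)
    (w : Hom2 C D) (v : Hom2 X C) (w' : Hom2 C' D) (v' : Hom2 X C')
    (e : w · v = w' · v') (x : F X) z (f : Hom _ z) :
  pk (f ∘ act F (idh e) x) = pk f.
Proof.
have -> : act F (idh e) x = idh (eq_trans (eq_sym (Farr_comp_ob w v x))
    (eq_trans (f_equal (fun u => Farr F u x) e) (Farr_comp_ob w' v' x))).
  apply: pk_inj; rewrite pk_act Fcell_idh !pk_idh.
  by rewrite Farr_comp_ob.
exact: pk_idhr.
Qed.

Lemma homotopicI1 (A : TwoCat) (F : TwoFunctor A) (X Y : LOb F) (C : A)
    (u u' : Hom2 (base X) C) (v v' : Hom2 (base Y) C)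
    (xi : Hom (Farr F u (pt X)) (Farr F v (pt Y)))
    (xi' : Hom (Farr F u' (pt X)) (Farr F v' (pt Y)))
    (a : Hom v v') (b : Hom u u') :
  isIso a -> isIso b -> Fcell F a (pt Y) ∘ xi = xi' ∘ Fcell F b (pt X) ->
  homotopic (@MkPreMor A F X Y C u v xi) (@MkPreMor A F X Y C u' v' xi').
Proof.
move=> ia ib e.
apply: (@homotopicI A F X Y (MkPreMor xi) (MkPreMor xi') C (id1 C) (id1 C)
         (id1 C ◁ a) (id1 C ◁ b));
  try exact: wl_iso.
rewrite /= !Fcell_wl !pk_Farr_id -!pk_comp; exact: (f_equal (fun f => pk f) e).
Qed.

Lemma pre_comp_choice (A : TwoCat) (hA : pre_two_filtered A) (F : TwoFunctor A)
    (X Y Z : LOb F) (q : PreMor Y Z) (p : PreMor X Y)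
    (D : A) (s : Hom2 (pC p) D) (t : Hom2 (pC q) D) (c : Hom (s · pv p) (t · pu q))
    (D' : A) (s' : Hom2 (pC p) D') (t' : Hom2 (pC q) D')
    (c' : Hom (s' · pv p) (t' · pu q)) :
  homotopic (pre_comp c) (pre_comp c').
Proof.
case: (proj2 hA _ _ _ _ _ _ _ _ _ _ _ c c') => E [w1 [w2 [a [b [ia [ib e]]]]]].
apply: (@homotopicI _ _ _ _ (pre_comp c) (pre_comp c') E w1 w2
          (whisk a (pv q)) (whisk b (pu p))); try exact: whisk_iso.
rewrite /= !fmap_castH !pk_castH !pk_whisk.
have := f_equal (fun f => pk (Fcell F f (pt Y))) e.
rewrite /= !Fcell_comp !pk_comp !pk_whisk !Fcell_wl => {}e.
have := f_equal (fun f => pk f) (naturality (Fcell F a) (pxi q)).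
rewrite /= !pk_comp !pk_Farr_comp => na.
have := f_equal (fun f => pk f) (naturality (Fcell F b) (pxi p)).
rewrite /= !pk_comp !pk_Farr_comp => nb.
rewrite !fmap_comp !pk_comp !pk_fmap_act.
by rewrite !mulA na -[mul (mul (pk (fmap _ (fmap _ (pxi q)))) _) _]mulA e
  -!mulA nb.
Qed.

Lemma pre_comp_l (A : TwoCat) (hA : pre_two_filtered A) (F : TwoFunctor A)
    (X Y Z : LOb F) (q : PreMor Y Z) (p p' : PreMor X Y)
    (D : A) (s : Hom2 (pC p) D) (t : Hom2 (pC q) D) (c : Hom (s · pv p) (t · pu q))
    (D' : A) (s' : Hom2 (pC p') D') (t' : Hom2 (pC q) D')
    (c' : Hom (s' · pv p') (t' · pu q)) :
  homotopic p p' -> homotopic (pre_comp c) (pre_comp c').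
Proof.
case=> E [w1 [w2 [a [b [ia [ib e]]]]]].
case: (ia) => a' [al ar].
case: (proj1 hA _ _ _ (w1 · pv p) (pu q)) => G [x [y [d id]]].
pose d1 : Hom ((x · w1) · pv p) (y · pu q) := castH (assoc1 _ _ _) eq_refl d.
pose d2 : Hom ((x · w2) · pv p') (y · pu q) :=
  castH (assoc1 _ _ _) eq_refl (d ∘ (x ◁ a')).
apply: (homotopic_trans hA (pre_comp_choice hA c d1)).
apply: (fun h => homotopic_trans hA h (pre_comp_choice hA d2 c')).
apply: (homotopicI1 (a := idm _)
  (b := castH (assoc1 x w1 (pu p)) (assoc1 x w2 (pu p')) (x ◁ b)));
  [exact: iso_id|by apply: iso_castH; apply: wl_iso|].
have := f_equal (fun f => pk (fmap (Farr F x) f)) e.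
rewrite !fmap_comp !pk_comp !pk_fmap_act => {}e.
have : mul (pk (fmap (Farr F x) (Fcell F a' (pt Y))))
   (pk (fmap (Farr F x) (Fcell F a (pt Y)))) =
   pk (fmap (Farr F x) (Fcell F (idm (w1 · pv p)) (pt Y))).
  by rewrite -pk_comp -fmap_comp -Fcell_comp al.
rewrite Fcell_id fmap_id => aa.
have pid : pk (idm (Farr F x (Farr F (w1 · pv p) (pt Y)))) =
    pk (idm (Farr F x (Farr F w1 (Farr F (pv p) (pt Y)))))
  by rewrite Farr_comp_ob.
apply: pk_inj; rewrite Fcell_id comp_idl /= pk_castH !pk_comp !pk_castH.
rewrite !pk_comp !pk_act /d1 /d2 !Fcell_castH Fcell_comp pk_comp !Fcell_wl.
rewrite !pk_Farr_comp -!mulA -e [mul (pk (fmap _ (Fcell F a' _))) _]mulA aa pid.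
by rewrite -[mul (pk (idm _)) _]pk_comp comp_idl.
Qed.

Lemma pre_comp_r (A : TwoCat) (hA : pre_two_filtered A) (F : TwoFunctor A)
    (X Y Z : LOb F) (q q' : PreMor Y Z) (p : PreMor X Y)
    (D : A) (s : Hom2 (pC p) D) (t : Hom2 (pC q) D) (c : Hom (s · pv p) (t · pu q))
    (D' : A) (s' : Hom2 (pC p) D') (t' : Hom2 (pC q') D')
    (c' : Hom (s' · pv p) (t' · pu q')) :
  homotopic q q' -> homotopic (pre_comp c) (pre_comp c').
Proof.
case=> E [w1 [w2 [a [b [ia [ib e]]]]]].
case: (proj1 hA _ _ _ (pv p) (w1 · pu q)) => G [x [y [d id]]].
pose d1 : Hom (x · pv p) ((y · w1) · pu q) := castH eq_refl (assoc1 _ _ _) d.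
pose d2 : Hom (x · pv p) ((y · w2) · pu q') :=
  castH eq_refl (assoc1 _ _ _) ((y ◁ b) ∘ d).
apply: (homotopic_trans hA (pre_comp_choice hA c d1)).
apply: (fun h => homotopic_trans hA h (pre_comp_choice hA d2 c')).
apply: (homotopicI1 (b := idm _)
  (a := castH (assoc1 y w1 (pv q)) (assoc1 y w2 (pv q')) (y ◁ a)));
  [by apply: iso_castH; apply: wl_iso|exact: iso_id|].
have := f_equal (fun f => pk (fmap (Farr F y) f)) e.
rewrite !fmap_comp !pk_comp !pk_fmap_act => {}e.
apply: pk_inj; rewrite Fcell_id comp_idr /= pk_castH !pk_comp !pk_castH.
rewrite !pk_comp !pk_act /d1 /d2 !Fcell_castH Fcell_comp pk_comp !Fcell_wl.
by rewrite !pk_Farr_comp !mulA e.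
Qed.

Lemma pre_comp_homotopic (A : TwoCat) (hA : pre_two_filtered A)
    (F : TwoFunctor A) (X Y Z : LOb F) (q q' : PreMor Y Z) (p p' : PreMor X Y)
    (D : A) (s : Hom2 (pC p) D) (t : Hom2 (pC q) D) (c : Hom (s · pv p) (t · pu q))
    (D' : A) (s' : Hom2 (pC p') D') (t' : Hom2 (pC q') D')
    (c' : Hom (s' · pv p') (t' · pu q')) :
  homotopic p p' -> homotopic q q' -> homotopic (pre_comp c) (pre_comp c').
Proof.
move=> hp hq.
case: (proj1 hA _ _ _ (pv p') (pu q)) => G [x [y [d id]]].
apply: (homotopic_trans hA (pre_comp_l hA (p' := p') c d hp)).
exact: pre_comp_r.
Qed.

Definition Lcomp_class (A : TwoCat) (F : TwoFunctor A) (X Y Z : LOb F)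
    (d : LHom Y Z) (c : LHom X Y) : PreMor X Z -> Prop :=
  fun r => exists (q : PreMor Y Z) (p : PreMor X Y) (D : A)
    (s : Hom2 (pC p) D) (t : Hom2 (pC q) D) (g : Hom (s · pv p) (t · pu q)),
    proj1_sig d q /\ proj1_sig c p /\ isIso g /\ homotopic (pre_comp g) r.

Lemma Lcomp_class_cls (A : TwoCat) (hA : pre_two_filtered A)
    (F : TwoFunctor A) (X Y Z : LOb F) (q : PreMor Y Z) (p : PreMor X Y)
    (D : A) (s : Hom2 (pC p) D) (t : Hom2 (pC q) D)
    (g : Hom (s · pv p) (t · pu q)) :
  isIso g -> Lcomp_class (cls q) (cls p) = homotopic (pre_comp g).
Proof.
move=> ig; apply: functional_extensionality => r.
apply: propositional_extensionality; split.
- case=> q' [p' [D' [s' [t' [g' [hq [hp [ig' h]]]]]]]].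
  apply: (homotopic_trans hA _ h); exact: pre_comp_homotopic.
- by move=> h; exists q, p, D, s, t, g; split;
    [exact: homotopic_refl|split; [exact: homotopic_refl|split]].
Qed.

Lemma Lcomp_subproof (A : TwoCat) (hA : pre_two_filtered A)
    (F : TwoFunctor A) (X Y Z : LOb F) (d : LHom Y Z) (c : LHom X Y) :
  exists r, Lcomp_class d c = homotopic r.
Proof.
case: (cls_surj d) (cls_surj c) => q -> [p ->].
case: (proj1 hA _ _ _ (pv p) (pu q)) => D [s [t [g ig]]].
by exists (pre_comp g); apply: Lcomp_class_cls.
Qed.

Definition Lcomp (A : TwoCat) (hA : pre_two_filtered A) (F : TwoFunctor A)
    (X Y Z : LOb F) (d : LHom Y Z) (c : LHom X Y) : LHom X Z :=
  exist _ (Lcomp_class d c) (Lcomp_subproof hA d c).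

Lemma Lcomp_cls (A : TwoCat) (hA : pre_two_filtered A)
    (F : TwoFunctor A) (X Y Z : LOb F) (q : PreMor Y Z) (p : PreMor X Y)
    (D : A) (s : Hom2 (pC p) D) (t : Hom2 (pC q) D)
    (g : Hom (s · pv p) (t · pu q)) :
  isIso g -> Lcomp hA (cls q) (cls p) = cls (pre_comp g).
Proof.
move=> ig; apply: eq_sig_hprop => [? ? ?|]; first exact: proof_irrelevance.
exact: Lcomp_class_cls.
Qed.

Lemma Lcomp_assoc (A : TwoCat) (hA : pre_two_filtered A) (F : TwoFunctor A)
    (X Y Z W : LOb F) (h : LHom Z W) (g : LHom Y Z) (f : LHom X Y) :
  Lcomp hA h (Lcomp hA g f) = Lcomp hA (Lcomp hA h g) f.
Proof.
case: (cls_surj f) (cls_surj g) (cls_surj h) => p -> [q ->] [r ->].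
case: (proj1 hA _ _ _ (pv p) (pu q)) => D [s [t [c ic]]].
case: (proj1 hA _ _ _ (t · pv q) (pu r)) => E [x [y [d id]]].
rewrite (Lcomp_cls hA ic).
rewrite (Lcomp_cls hA (p := pre_comp c) (q := r) (g := d) id).
have i1 : isIso (castH (assoc1 x t (pv q)) eq_refl d) by apply: iso_castH.
rewrite (Lcomp_cls hA i1).
set r1 := @pre_comp A F Y Z W r q E (x · t) y _.
pose c' : Hom ((x · s) · pv p) (id1 E · pu r1) :=
  castH (assoc1 x s (pv p))
    (eq_trans (assoc1 x t (pu q)) (eq_sym (idl1 _))) (x ◁ c).
have i2 : isIso c' by apply: iso_castH; apply: wl_iso.
rewrite (Lcomp_cls hA (q := r1) (p := p) i2); congr cls.
apply: pre_eq; [by rewrite assoc1|by rewrite idl1|].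
by rewrite /r1 /c' /= !pkFE !mulA.
Qed.

Lemma Lcomp_idl (A : TwoCat) (hA : pre_two_filtered A) (F : TwoFunctor A)
    (X Y : LOb F) (f : LHom X Y) : Lcomp hA (cls (pre_id Y)) f = f.
Proof.
case: (cls_surj f) => p ->.
pose e : id1 (pC p) · pv p = pv p · id1 (base Y) :=
  eq_trans (idl1 _) (eq_sym (idr1 _)).
rewrite (Lcomp_cls hA (q := pre_id Y) (iso_idh e)); congr cls.
case: p e => C u v xi /= e; apply: pre_eq; [exact: idl1|exact: idr1|].
by rewrite pk_castH /= fmap_id comp_idl pk_act_idhl pk_Farr_id.
Qed.

Lemma Lcomp_idr (A : TwoCat) (hA : pre_two_filtered A) (F : TwoFunctor A)
    (X Y : LOb F) (f : LHom X Y) : Lcomp hA f (cls (pre_id X)) = f.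
Proof.
case: (cls_surj f) => p ->.
pose e : pu p · id1 (base X) = id1 (pC p) · pu p :=
  eq_trans (idr1 _) (eq_sym (idl1 _)).
rewrite (Lcomp_cls hA (p := pre_id X) (iso_idh e)); congr cls.
case: p e => C u v xi /= e; apply: pre_eq; [exact: idr1|exact: idl1|].
by rewrite pk_castH /= fmap_id comp_idr pk_act_idhr pk_Farr_id.
Qed.

Definition LCat (A : TwoCat) (hA : pre_two_filtered A) (F : TwoFunctor A) :
    Category :=
  @MkCategory (LOb F) (@LHom A F) (fun X => cls (pre_id X)) (@Lcomp A hA F)
    (@Lcomp_assoc A hA F) (@Lcomp_idl A hA F) (@Lcomp_idr A hA F).

(* The equations between natural transformations are stated componentwise. *)
Record PseudoCone (A : TwoCat) (F : TwoFunctor A) (X : Category) : Type :=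
  MkPseudoCone {
    leg : forall B : A, Functor (F B) X;
    tr : forall (B C : A) (u : Hom2 B C),
      NatTrans (compF (leg C) (Farr F u)) (leg B);
    tr_iso : forall (B C : A) (u : Hom2 B C),
      @isIso (FunCat (F B) X) _ _ (tr u);
    tr_id : forall (B : A) (x : F B), tr (id1 B) x ≡ idm (leg B x);
    tr_comp : forall (B C D : A) (v : Hom2 C D) (u : Hom2 B C) (x : F B),
      tr (v · u) x ≡ tr u x ∘ tr v (Farr F u x);
    tr_cell : forall (B C : A) (u v : Hom2 B C) (g : Hom u v) (x : F B),
      tr v x ∘ fmap (leg C) (Fcell F g x) = tr u x }.

Lemma Lcomp_idh (A : TwoCat) (hA : pre_two_filtered A) (F : TwoFunctor A)
    (X Y Z : LOb F) (C1 C2 D : A)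
    (u1 : Hom2 (base X) C1) (v1 : Hom2 (base Y) C1)
    (xi1 : Hom (Farr F u1 (pt X)) (Farr F v1 (pt Y)))
    (u2 : Hom2 (base Y) C2) (v2 : Hom2 (base Z) C2)
    (xi2 : Hom (Farr F u2 (pt Y)) (Farr F v2 (pt Z)))
    (s : Hom2 C1 D) (t : Hom2 C2 D) (u : Hom2 (base X) D)
    (v : Hom2 (base Z) D) (xi : Hom (Farr F u (pt X)) (Farr F v (pt Z))) :
  s · v1 = t · u2 -> s · u1 = u -> t · v2 = v ->
  pk xi = mul (pk (fmap (Farr F t) xi2)) (pk (fmap (Farr F s) xi1)) ->
  @comp (LCat hA F) X Y Z (cls (MkPreMor xi2)) (cls (MkPreMor xi1)) =
  cls (MkPreMor xi).
Proof.
move=> e eu ev ex.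
rewrite /= (Lcomp_cls hA (q := MkPreMor xi2) (p := MkPreMor xi1) (iso_idh e)).
congr cls; apply: pre_eq => //.
by rewrite pk_castH pk_comp pk_act_idhr ex.
Qed.

Lemma pk_cls (A : TwoCat) (hA : pre_two_filtered A) (F : TwoFunctor A)
    (B B' C : A) (x x' : F B) (y y' : F B') (u u' : Hom2 B C) (v v' : Hom2 B' C)
    (xi : Hom (Farr F u x) (Farr F v y)) (xi' : Hom (Farr F u' x') (Farr F v' y')) :
  x = x' -> y = y' -> u = u' -> v = v' -> pk xi = pk xi' ->
  @pk (LCat hA F) _ _ (cls (@MkPreMor A F (MkLOb x) (MkLOb y) C u v xi)) =
  @pk (LCat hA F) _ _ (cls (@MkPreMor A F (MkLOb x') (MkLOb y') C u' v' xi')).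
Proof. by move=> ? ? ? ? e; subst; rewrite (pk_inj e). Qed.

(* λ_B(ξ) is the class of (id, ξ, id); the middle component has to be a morphism
   (id)x → (id)y, so ξ appears as (id)ξ. *)
Definition lam_leg (A : TwoCat) (hA : pre_two_filtered A) (F : TwoFunctor A)
  (B : A) : Functor (F B) (LCat hA F).
Proof.
refine (@MkFunctor (F B) (LCat hA F) (fun x => MkLOb x)
  (fun x y xi => cls (@MkPreMor A F (MkLOb x) (MkLOb y) B (id1 B) (id1 B)
     (fmap (Farr F (id1 B)) xi))) _ _).
- by move=> x; rewrite fmap_id.
- move=> x y z g f; symmetry.
  apply: (Lcomp_idh hA (s := id1 B) (t := id1 B)); rewrite /= ?idl1 //.
  by rewrite !pk_Farr_id pk_comp.
Defined.

Definition lam_tr_at (A : TwoCat) (F : TwoFunctor A)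
    (B C : A) (u : Hom2 B C) (x : F B) :
    LHom (MkLOb (Farr F u x)) (MkLOb x) :=
  cls (@MkPreMor A F (MkLOb (Farr F u x)) (MkLOb x) C (id1 C) u
        (idh (Farr_id_ob (Farr F u x)))).

Definition lam_tr (A : TwoCat) (hA : pre_two_filtered A) (F : TwoFunctor A)
    (B C : A) (u : Hom2 B C) :
  NatTrans (compF (lam_leg hA F C) (Farr F u)) (lam_leg hA F B).
Proof.
refine (@MkNatTrans (F B) (LCat hA F) (compF (lam_leg hA F C) (Farr F u))
          (lam_leg hA F B) (fun x => lam_tr_at u x) _).
move=> x y f; rewrite /= /lam_tr_at.
pose xi : Hom (Farr F (id1 C) (Farr F u x)) (Farr F u y) :=
  castH (eq_sym (Farr_id_ob (Farr F u x))) eq_refl (fmap (Farr F u) f).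
transitivity (cls (@MkPreMor A F (MkLOb (Farr F u x)) (MkLOb y) C (id1 C) u xi)).
- apply: (Lcomp_idh hA (s := id1 C) (t := id1 C)); rewrite /= ?idl1 //.
  by rewrite fmap_idh -pk_comp pk_idhl !pk_Farr_id pk_castH.
- symmetry; apply: (Lcomp_idh hA (s := id1 C) (t := u));
    rewrite /= ?idl1 ?idr1 //.
  rewrite pk_Farr_id /xi pk_castH (pk_fmap (eq_refl (Farr F u)) (pk_Farr_id f)).
  by rewrite -pk_comp pk_idhr.
Defined.

Lemma cls_unit (A : TwoCat) (hA : pre_two_filtered A) (F : TwoFunctor A)
    (X : LOb F) (C : A) (u : Hom2 (base X) C) :
  cls (@MkPreMor A F X X C u u (idm (Farr F u (pt X)))) = idm (X : LCat hA F).
Proof.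
apply: (cls_eq hA).
pose e : id1 C · u = u · id1 (base X) := eq_trans (idl1 u) (eq_sym (idr1 u)).
exists C, (id1 C), u, (idh e), (idh e).
split; [exact: iso_idh|split; [exact: iso_idh|]].
apply: pk_inj; rewrite pk_act_idhl pk_act_idhr /= !fmap_id.
by rewrite !Farr_id_ob.
Qed.

Lemma lam_tr_iso (A : TwoCat) (hA : pre_two_filtered A) (F : TwoFunctor A)
    (B C : A) (u : Hom2 B C) :
  @isIso (FunCat (F B) (LCat hA F)) _ _ (lam_tr hA F u).
Proof.
apply: nat_iso => x /=; rewrite /lam_tr_at.
exists (cls (@MkPreMor A F (MkLOb x) (MkLOb (Farr F u x)) C u (id1 C)
        (idh (eq_sym (Farr_id_ob (Farr F u x)))))); split.
- apply: (Lcomp_idh hA (s := id1 C) (t := id1 C)); rewrite /= ?idl1 //.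
  by rewrite !fmap_idh -pk_comp pk_idhl !pk_idh !Farr_id_ob.
- rewrite -(cls_unit hA u (X := MkLOb x)).
  apply: (Lcomp_idh hA (s := id1 C) (t := id1 C)); rewrite /= ?idl1 //.
  by rewrite !fmap_idh -pk_comp pk_idhl !pk_idh !Farr_id_ob.
Qed.

(* The 2-cell g need not be invertible; [axiom_F2] replaces it by an invertible one. *)
Lemma lam_tr_cell (A : TwoCat) (hA : pre_two_filtered A) (F : TwoFunctor A)
    (B C : A) (u v : Hom2 B C) (g : Hom u v) (x : F B) :
  lam_tr hA F v x ∘ fmap (lam_leg hA F C) (Fcell F g x) = lam_tr hA F u x.
Proof.
pose xi : Hom (Farr F (id1 C) (Farr F u x)) (Farr F v x) :=
  castH (eq_sym (Farr_id_ob (Farr F u x))) eq_refl (Fcell F g x).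
transitivity (cls (@MkPreMor A F (MkLOb (Farr F u x)) (MkLOb x) C (id1 C) v xi)).
  apply: (Lcomp_idh hA (s := id1 C) (t := id1 C)); rewrite /= ?idl1 //.
  by rewrite fmap_idh -pk_comp pk_idhl !pk_Farr_id pk_castH.
apply: (cls_eq hA).
pose g1 : Hom (id1 C · u) (v · id1 B) :=
  castH (eq_sym (idl1 u)) (eq_sym (idr1 v)) g.
pose g2 : Hom (id1 C · u) (u · id1 B) := idh (eq_trans (idl1 u) (eq_sym (idr1 u))).
case: (proj2 hA _ _ _ _ _ _ _ _ _ _ _ g1 g2) => D [w1 [w2 [a [b [ia [ib e]]]]]].
apply: (@homotopicI A F (MkLOb (Farr F u x)) (MkLOb x)
  (@MkPreMor A F (MkLOb (Farr F u x)) (MkLOb x) C (id1 C) v xi)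
  (@MkPreMor A F (MkLOb (Farr F u x)) (MkLOb x) C (id1 C) u
        (idh (Farr_id_ob (Farr F u x)))) D w1 w2 a b ia ib).
have := f_equal (fun f => pk (Fcell F f x)) e.
rewrite /= !Fcell_comp !pk_comp !pk_whisk !Fcell_wl Farr_id_ob.
have -> : pk (fmap (Farr F w1) (Fcell F g1 x)) = pk (fmap (Farr F w1) xi).
  by apply: pk_fmap; rewrite // Fcell_castH /xi pk_castH.
have -> // : pk (fmap (Farr F w2) (Fcell F g2 x)) =
  pk (fmap (Farr F w2) (idh (Farr_id_ob (Farr F u x)))).
by apply: pk_fmap; rewrite // Fcell_idh !pk_idh Farr_comp_ob.
Qed.

Definition lam (A : TwoCat) (hA : pre_two_filtered A) (F : TwoFunctor A) :
  PseudoCone F (LCat hA F).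
Proof.
refine (@MkPseudoCone A F (LCat hA F) (lam_leg hA F) (lam_tr hA F)
  (@lam_tr_iso A hA F) _ _ (@lam_tr_cell A hA F)).
- move=> B x; apply: pk_heq; rewrite /= /lam_tr_at /pre_id.
  apply: pk_cls => //; first exact: Farr_id_ob.
  by rewrite pk_idh Farr_id_ob.
- move=> B C D v u x; apply: pk_heq.
  rewrite /= /lam_tr_at.
  pose xi : Hom (Farr F (id1 D) (Farr F v (Farr F u x))) (Farr F (v · u) x) :=
    idh (eq_trans (Farr_id_ob _) (eq_sym (Farr_comp_ob v u x))).
  transitivity (@pk (LCat hA F) _ _ (cls
    (@MkPreMor A F (MkLOb (Farr F v (Farr F u x))) (MkLOb x) D (id1 D) (v · u) xi))).
    apply: pk_cls => //; first exact: Farr_comp_ob.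
    by rewrite !pk_idh Farr_comp_ob.
  f_equal; symmetry.
  apply: (Lcomp_idh hA (s := id1 D) (t := v)); rewrite /= ?idl1 ?idr1 //.
  by rewrite /xi !fmap_idh !pk_idh !Farr_id_ob -pk_comp comp_idl.
Defined.

Definition tr_at_iso (A : TwoCat) (F : TwoFunctor A) (X : Category)
    (h : PseudoCone F X) (B C : A) (u : Hom2 B C) (x : F B) :
  isIso (tr h u x) := iso_component x (tr_iso h u).

(* The value (h_v)_y ∘ h_C(ξ) ∘ (h_u)_x⁻¹ on a premorphism. *)
Definition pre_val (A : TwoCat) (F : TwoFunctor A) (X : Category)
    (h : PseudoCone F X) (Y Z : LOb F) (p : PreMor Y Z) :
    Hom (leg h (base Y) (pt Y)) (leg h (base Z) (pt Z)) :=
  tr h (pv p) (pt Z) ∘ fmap (leg h (pC p)) (pxi p) ∘ inv (tr_at_iso h (pu p) (pt Y)).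

Lemma pre_valE (A : TwoCat) (F : TwoFunctor A) (X : Category)
    (h : PseudoCone F X) (Y Z : LOb F) (p : PreMor Y Z) :
  pre_val h p ∘ tr h (pu p) (pt Y) =
  tr h (pv p) (pt Z) ∘ fmap (leg h (pC p)) (pxi p).
Proof. by rewrite /pre_val -comp_assoc inv_l comp_idr. Qed.

Lemma pre_val_unique (A : TwoCat) (F : TwoFunctor A) (X : Category)
    (h : PseudoCone F X) (Y Z : LOb F) (p : PreMor Y Z)
    (f : Hom (leg h (base Y) (pt Y)) (leg h (base Z) (pt Z))) :
  f ∘ tr h (pu p) (pt Y) = tr h (pv p) (pt Z) ∘ fmap (leg h (pC p)) (pxi p) ->
  f = pre_val h p.
Proof. by rewrite -pre_valE; apply: iso_epi; apply: tr_at_iso. Qed.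

Lemma val_shift (A : TwoCat) (F : TwoFunctor A) (X : Category)
    (h : PseudoCone F X) (Y Z : LOb F) (p : PreMor Y Z)
    (f : Hom (leg h (base Y) (pt Y)) (leg h (base Z) (pt Z)))
    (D : A) (w : Hom2 (pC p) D) :
  f ∘ tr h (pu p) (pt Y) = tr h (pv p) (pt Z) ∘ fmap (leg h (pC p)) (pxi p) ->
  mul (pk f) (pk (tr h (w · pu p) (pt Y))) =
  mul (pk (tr h (w · pv p) (pt Z))) (pk (fmap (leg h D) (fmap (Farr F w) (pxi p)))).
Proof.
move=> e; rewrite !(heq_pk (tr_comp h _ _ _)) !pk_comp mulA -(pk_comp f) e.
have := f_equal (fun f => pk f) (naturality (tr h w) (pxi p)).
by rewrite /= !pk_comp -!mulA => ->.
Qed.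

Lemma pre_val_homotopic (A : TwoCat) (F : TwoFunctor A) (X : Category)
    (h : PseudoCone F X) (Y Z : LOb F) (p q : PreMor Y Z) :
  homotopic p q -> pre_val h p = pre_val h q.
Proof.
case=> D [w1 [w2 [a [b [ia [ib e]]]]]].
move: (pre_valE h p) (pre_valE h q).
move: (pre_val h p) (pre_val h q) => f g ef eg.
apply: (iso_epi (tr_at_iso h (w1 · pu p) (pt Y))).
apply: pk_inj; rewrite !pk_comp (val_shift w1 ef).
rewrite -(tr_cell h a) -(tr_cell h b) !pk_comp mulA (val_shift w2 eg) -!mulA.
f_equal.
have := f_equal (fun f => pk (fmap (leg h D) f)) e.
rewrite /= !fmap_comp !pk_comp.
have E C C' B (w : Hom2 C D) (v : Hom2 B C) (w' : Hom2 C' D) (v' : Hom2 B C')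
    (c : Hom (w · v) (w' · v')) (x : F B) :
    pk (fmap (leg h D) (act F c x)) = pk (fmap (leg h D) (Fcell F c x)).
  by apply: pk_fmap => //; rewrite pk_act.
by rewrite !E.
Qed.

Lemma pre_val_id (A : TwoCat) (F : TwoFunctor A) (X : Category)
    (h : PseudoCone F X) (Y : LOb F) : pre_val h (pre_id Y) = idm _.
Proof.
by symmetry; apply: pre_val_unique; rewrite /= fmap_id comp_idl comp_idr.
Qed.

Lemma pre_val_comp (A : TwoCat) (F : TwoFunctor A) (X : Category)
    (h : PseudoCone F X) (Y Z W : LOb F) (q : PreMor Z W) (p : PreMor Y Z)
    (D : A) (s : Hom2 (pC p) D) (t : Hom2 (pC q) D)
    (c : Hom (s · pv p) (t · pu q)) :
  pre_val h (pre_comp c) = pre_val h q ∘ pre_val h p.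
Proof.
symmetry; apply: pre_val_unique => /=.
move: (pre_valE h p) (pre_valE h q).
move: (pre_val h p) (pre_val h q) => f g ef eg.
apply: pk_inj; rewrite !pk_comp -mulA (val_shift s ef) -(tr_cell h c) pk_comp.
rewrite !mulA (val_shift t eg) fmap_castH pk_castH !fmap_comp !pk_comp -!mulA.
f_equal; f_equal; f_equal => /=.
by apply: pk_fmap => //; rewrite pk_act.
Qed.

Definition rep (A : TwoCat) (F : TwoFunctor A) (Y Z : LOb F) (c : LHom Y Z) :
    PreMor Y Z :=
  proj1_sig (constructive_indefinite_description _ (cls_surj c)).

Lemma cls_rep (A : TwoCat) (F : TwoFunctor A) (Y Z : LOb F) (c : LHom Y Z) :
  cls (rep c) = c.
Proof. by rewrite /rep; case: constructive_indefinite_description. Qed.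

Lemma pre_val_rep (A : TwoCat) (F : TwoFunctor A) (X : Category)
    (h : PseudoCone F X) (Y Z : LOb F) (p : PreMor Y Z) :
  pre_val h (rep (cls p)) = pre_val h p.
Proof. by apply/pre_val_homotopic/cls_homotopic/cls_rep. Qed.

(* The functor L(F) → X written h with a tilde; see [induced_leg], [induced_tr]
   and [induced_unique]. *)
Definition induced (A : TwoCat) (hA : pre_two_filtered A) (F : TwoFunctor A)
    (X : Category) (h : PseudoCone F X) : Functor (LCat hA F) X.
Proof.
refine (@MkFunctor (LCat hA F) X (fun Y => leg h (base Y) (pt Y))
  (fun Y Z c => pre_val h (rep c)) _ _).
- by move=> Y; rewrite /= pre_val_rep pre_val_id.
- move=> Y Z W g f /=.
  rewrite -(cls_rep g) -(cls_rep f) !pre_val_rep.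
  case: (proj1 hA _ _ _ (pv (rep f)) (pu (rep g))) => D [s [t [c ic]]].
  by rewrite (Lcomp_cls hA ic) pre_val_rep pre_val_comp.
Defined.

Lemma induced_cls (A : TwoCat) (hA : pre_two_filtered A) (F : TwoFunctor A)
    (X : Category) (h : PseudoCone F X) (Y Z : LOb F) (p : PreMor Y Z) :
  @fmap _ _ (induced hA h) Y Z (cls p) = pre_val h p.
Proof. exact: pre_val_rep. Qed.

Lemma induced_leg (A : TwoCat) (hA : pre_two_filtered A) (F : TwoFunctor A)
    (X : Category) (h : PseudoCone F X) (B : A) :
  compF (induced hA h) (leg (lam hA F) B) = leg h B.
Proof.
apply: functor_ext => // x y f; apply: pk_heq.
rewrite /= pre_val_rep; congr pk; symmetry.
apply: (@pre_val_unique A F X h (MkLOb x) (MkLOb y) (MkPreMor _)).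
symmetry; exact: (naturality (tr h (id1 B)) f).
Qed.

Lemma induced_tr (A : TwoCat) (hA : pre_two_filtered A) (F : TwoFunctor A)
    (X : Category) (h : PseudoCone F X) (B C : A) (u : Hom2 B C) (x : F B) :
  fmap (induced hA h) (tr (lam hA F) u x) = tr h u x.
Proof.
rewrite /= pre_val_rep; symmetry.
apply: (@pre_val_unique A F X h (MkLOb (Farr F u x)) (MkLOb x) (MkPreMor _)).
apply: pk_inj; rewrite /= fmap_idh pk_idhr pk_comp (heq_pk (tr_id h _)).
by rewrite -pk_comp comp_idr.
Qed.

(* [(u,ξ,v)] ∘ (λ_u)_x = (λ_v)_y ∘ λ_C(ξ). *)
Lemma cls_decomp (A : TwoCat) (hA : pre_two_filtered A) (F : TwoFunctor A)
    (B B' : A) (x : F B) (y : F B') (p : PreMor (MkLOb x) (MkLOb y)) :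
  @comp (LCat hA F) _ (MkLOb x) (MkLOb y) (cls p) (tr (lam hA F) (pu p) x) =
  tr (lam hA F) (pv p) y ∘ fmap (leg (lam hA F) (pC p)) (pxi p).
Proof.
case: p => C u v xi /=; rewrite /lam_tr_at.
pose xi' : Hom (Farr F (id1 C) (Farr F u x)) (Farr F v y) :=
  castH (eq_sym (Farr_id_ob (Farr F u x))) eq_refl xi.
transitivity (cls
    (@MkPreMor A F (MkLOb (Farr F u x)) (MkLOb y) C (id1 C) v xi')).
  apply: (Lcomp_idh hA (s := id1 C) (t := id1 C)); rewrite /= ?idl1 //.
  by rewrite /xi' pk_castH !pk_Farr_id -pk_comp pk_idhr.
symmetry; apply: (Lcomp_idh hA (s := id1 C) (t := id1 C)); rewrite /= ?idl1 //.
by rewrite /xi' fmap_idh -pk_comp pk_idhl pk_castH !pk_Farr_id.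
Qed.

Lemma induced_unique (A : TwoCat) (hA : pre_two_filtered A) (F : TwoFunctor A)
    (X : Category) (h : PseudoCone F X) (G : Functor (LCat hA F) X) :
  (forall B : A, compF G (leg (lam hA F) B) = leg h B) ->
  (forall (B C : A) (u : Hom2 B C) (x : F B),
     fmap G (tr (lam hA F) u x) ≡ tr h u x) ->
  G = induced hA h.
Proof.
move=> Gl Gt.
have Go (Y : LOb F) : G Y = leg h (base Y) (pt Y).
  by case: Y => B x; rewrite -Gl.
apply: functor_ext => // -[B x] [B' y] c; apply: pk_heq.
rewrite -(cls_rep c) induced_cls; move: (rep c) => {c} p.
rewrite -(pk_castH (Go (MkLOb x)) (Go (MkLOb y))); congr pk; apply: pre_val_unique.
have El : pk (fmap (leg h (pC p)) (pxi p)) =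
    pk (fmap G (fmap (leg (lam hA F) (pC p)) (pxi p))) by rewrite -Gl.
apply: pk_inj; rewrite /= !pk_comp pk_castH El -!(heq_pk (Gt _ _ _ _)).
have := f_equal (fun f => pk (fmap G f)) (cls_decomp hA p).
by rewrite !fmap_comp !pk_comp.
Qed.

Definition postF (P X Y : Category) (G : Functor X Y) :
  Functor (FunCat P X) (FunCat P Y).
Proof.
refine (@MkFunctor (FunCat P X) (FunCat P Y) (fun K => compF G K)
  (fun K L s => hcompN (idN G) s) _ _).
- by move=> K; apply: nat_ext => i /=; rewrite fmap_id comp_idl.
- by move=> K L M t s; apply: nat_ext => i /=; rewrite fmap_comp !comp_idl.
Defined.

Definition postN (P X Y : Category) (G H : Functor X Y) (s : NatTrans G H) :
  NatTrans (postF P G) (postF P H).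
Proof.
refine (@MkNatTrans (FunCat P X) (FunCat P Y) (postF P G) (postF P H)
  (fun K => hcompN s (idN K)) _).
move=> K L t; apply: nat_ext => i /=.
by rewrite !fmap_id !comp_idr !comp_idl naturality.
Defined.

Definition postFun (P X Y : Category) :
  Functor (FunCat X Y) (FunCat (FunCat P X) (FunCat P Y)).
Proof.
refine (@MkFunctor (FunCat X Y) (FunCat (FunCat P X) (FunCat P Y))
  (@postF P X Y) (@postN P X Y) _ _).
- move=> G; apply: nat_ext => K; apply: nat_ext => i /=.
  by rewrite fmap_id comp_idl.
- move=> G H K t s; apply: nat_ext => L; apply: nat_ext => i /=.
  by rewrite !fmap_id !comp_idr.
Defined.

Lemma compF_idl (P X : Category) (K : Functor P X) : compF (idF X) K = K.
Proof. exact: functor_ext. Qed.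

Lemma compF_assoc (P X Y Z : Category) (H : Functor Y Z) (G : Functor X Y)
  (K : Functor P X) : compF (compF H G) K = compF H (compF G K).
Proof. exact: functor_ext. Qed.

Lemma postF_id (P X : Category) : postF P (idF X) = idF (FunCat P X).
Proof.
apply: functor_ext => [K|K L s]; first exact: compF_idl.
apply: nat_heq; try exact: compF_idl.
by move=> i /=; rewrite comp_idl.
Qed.

Lemma postF_comp (P X Y Z : Category) (H : Functor Y Z) (G : Functor X Y) :
  postF P (compF H G) = compF (postF P H) (postF P G).
Proof.
apply: functor_ext => [K|K L s]; first exact: compF_assoc.
apply: nat_heq; try exact: compF_assoc.
by move=> i /=; rewrite !comp_idl.
Qed.

Lemma postN_hcomp (P X Y Z : Category) (H H' : Functor Y Z) (G G' : Functor X Y)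
    (t : NatTrans H H') (s : NatTrans G G') :
  @HomEq (FunCat (FunCat P X) (FunCat P Z)) _ _ (postN P (hcompN t s))
    (compF (postF P H) (postF P G)) (compF (postF P H') (postF P G'))
    (hcompN (postN P t) (postN P s)).
Proof.
apply: nat_heq; try exact: postF_comp.
move=> K; apply: heq_pk; apply: nat_heq; try exact: compF_assoc.
by move=> i /=; rewrite !fmap_id !comp_idr comp_idl.
Qed.

Definition powF (A : TwoCat) (F : TwoFunctor A) (P : Category) : TwoFunctor A.
Proof.
refine (@MkTwoFunctor A (fun B => FunCat P (F B))
  (fun B C => compF (postFun P (F B) (F C)) (Fhom F B C)) _ _ _).
- by move=> B /=; rewrite Fhom_id postF_id.
- by move=> B C D v u /=; rewrite Fhom_comp postF_comp.
- move=> B C D v v' u u' b a.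
  apply: pk_heq.
  transitivity (@pk (FunCat (FunCat P (F B)) (FunCat P (F D))) _ _
    (postN P (hcompN (fmap (Fhom F C D) b) (fmap (Fhom F B C) a)))).
    exact: (pk_fmap (eq_refl (postFun P (F B) (F D)))
              (heq_pk (Fhom_comp2 F b a))).
  exact: heq_pk (postN_hcomp P _ _).
Defined.

Definition powCone_tr_at (A : TwoCat) (F : TwoFunctor A) (X : Category)
    (h : PseudoCone F X) (P : Category) (B C : A) (u : Hom2 B C)
    (K : Functor P (F B)) :
  NatTrans (compF (leg h C) (compF (Farr F u) K)) (compF (leg h B) K) :=
  @MkNatTrans P X (compF (leg h C) (compF (Farr F u) K)) (compF (leg h B) K)
    (fun i => tr h u (K i)) (fun i j f => naturality (tr h u) (fmap K f)).

Definition powCone_tr (A : TwoCat) (F : TwoFunctor A) (X : Category)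
    (h : PseudoCone F X) (P : Category) (B C : A) (u : Hom2 B C) :
  NatTrans (compF (postF P (leg h C)) (Farr (powF F P) u)) (postF P (leg h B)).
Proof.
refine (@MkNatTrans (FunCat P (F B)) (FunCat P X)
  (compF (postF P (leg h C)) (Farr (powF F P) u)) (postF P (leg h B))
  (fun K => powCone_tr_at h u K) _).
move=> K L s; apply: nat_ext => i /=.
rewrite !comp_idl; exact: (naturality (tr h u)).
Defined.

(* The pseudocone F^P ⇒ X^P obtained from F ⇒ X by post-composition. *)
Definition powCone (A : TwoCat) (F : TwoFunctor A) (X : Category)
    (h : PseudoCone F X) (P : Category) : PseudoCone (powF F P) (FunCat P X).
Proof.
refine (@MkPseudoCone A (powF F P) (FunCat P X) (fun B => postF P (leg h B))
  (@powCone_tr A F X h P) _ _ _ _).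
- move=> B C u; apply: nat_iso => K; apply: nat_iso => i; exact: tr_at_iso.
- move=> B K; apply: nat_heq => //.
    by rewrite /= /Farr /= Fhom_id compF_idl.
  move=> i; exact: heq_pk (tr_id h (K i)).
- move=> B C D v u K; apply: nat_heq => //.
    by rewrite /= /Farr /= Fhom_comp compF_assoc.
  move=> i; exact: heq_pk (tr_comp h v u (K i)).
- move=> B C u v g K; apply: nat_ext => i /=.
  by rewrite fmap_id comp_idl comp_idr; apply: tr_cell.
Defined.

(* Corresponds under the universal property of L(F^P) to the pseudocone
   F^P ⇒ L(F)^P with components (λ_A)^P and (λ_u)^P. *)
Definition Diamond (A : TwoCat) (hA : pre_two_filtered A) (F : TwoFunctor A)
    (P : Category) : Functor (LCat hA (powF F P)) (FunCat P (LCat hA F)) :=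
  induced hA (powCone (lam hA F) P).

(* Main.v *)
From Corelib Require Import ssreflect.
From Stdlib Require Import IndefiniteDescription List FinFun.
Require Import Defs.

Set Implicit Arguments.
Unset Strict Implicit.
Unset Printing Implicit Defensive.

(** The theorem says that finite diagrams, together with finitely many
    equations between their arrows, can be pulled back along the cone
    λ : F ⇒ L(F) to one single stage of F.  As in the case of ordinary filtered
    colimits of categories, this becomes transparent once colimit cones are
    recognized by elementary conditions.  Call a pseudocone h : F ⇒ X filtered
    ([filtered_cone]) when
    - every object of X is isomorphic to some h_C(x);
    - an arrow h_B(x) → h_C(y) exists only if B and C map to a common object;
    - every arrow h_C(x) → h_C(y) becomes, after transport along some
      w : C → C', the image of an arrow wx → wy of FC';
    - if h_C(f) = h_C(g), then wf = wg for some w : C → C'.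

    Three facts give the result.  The cone λ is filtered
    ([filtered_cone_lam]): by FF1 the two legs of a premorphism between objects
    over C may be taken equal, which lifts arrows, and by F3 the two 2-cells of a
    homotopy may be taken equal, which turns a homotopy into an equation
    wf = wg.  If h is filtered, then so is h^P for finite P
    ([filtered_cone_powCone]): the last two conditions persist under further
    transport, so that finitely many arrows can be lifted, and finitely many
    equations enforced, by one w; the objects of a diagram are first moved over a
    common base, which uses F0 or the connectedness of P.  Finally, a filtered
    cone induces an equivalence L(F) → X ([induced_equivalence]).  The functor ◇
    is the one induced by the cone λ^P.

    The objects (w'w)x and w'(wx) are equal only propositionally.  Diagrams and
    transformations are therefore built from iterated images w'(wx), and the
    casts that remain are removed by passing to the untyped arrows [pk]. *)

(** * Equivalences of categories *)

Lemma iso_mono (C : Category) (a b c : C) (e : Hom b c) (f g : Hom a b) :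
  isIso e -> e ∘ f = e ∘ g -> f = g.
Proof.
by move=> i E; rewrite -(comp_idl f) -(comp_idl g) -(inv_l i) -!comp_assoc E.
Qed.

(** The inverse takes each object d to a chosen c with Gc ≅ d; its action on
    arrows, and the unit, are obtained by lifting along G. *)
Lemma equivalence_of_fully_faithful (C D : Category) (G : Functor C D) :
  (forall (a b : C) (f g : Hom a b), fmap G f = fmap G g -> f = g) ->
  (forall (a b : C) (d : Hom (G a) (G b)), exists f, fmap G f = d) ->
  (forall d : D, exists (c : C) (e : Hom (G c) d), isIso e) ->
  is_equivalence G.
Proof.
move=> faithful full surj.
have iso_reflect a b (f : Hom a b) : isIso (fmap G f) -> isIso f.
  case=> d [dl dr]; case: (full _ _ d) => g eg.
  by exists g; split; apply: (faithful); rewrite fmap_comp fmap_id eg.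
have surj' d : exists k : {c : C & Hom (G c) d}, isIso (projT2 k).
  by case: (surj d) => c [e ie]; exists (existT _ c e).
pose k d := proj1_sig (constructive_indefinite_description _ (surj' d)).
pose e d : Hom (G (projT1 (k d))) d := projT2 (k d).
have ie d : isIso (e d).
  by rewrite /e /k; case: constructive_indefinite_description.
pose lift a b (d : Hom (G a) (G b)) :=
  proj1_sig (constructive_indefinite_description _ (full a b d)).
have liftP a b d : fmap G (lift a b d) = d.
  by rewrite /lift; case: constructive_indefinite_description.
unshelve epose (K := @MkFunctor D C (fun d => projT1 (k d))
  (fun d d' f => lift _ _ (inv (ie d') ∘ (f ∘ e d))) _ _).
{ by move=> d; apply: (faithful); rewrite liftP comp_idl inv_l fmap_id. }
{ move=> d d' d'' g f; apply: (faithful); rewrite fmap_comp !liftP.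
  by rewrite -!comp_assoc [e d' ∘ _]comp_assoc inv_r comp_idl. }
unshelve epose (eta := @MkNatTrans C C (idF C) (compF K G)
  (fun c => lift c (projT1 (k (G c))) (inv (ie (G c)))) _).
{ move=> a b f; apply: (faithful); rewrite /= !fmap_comp !liftP.
  by rewrite -!comp_assoc inv_r comp_idr. }
unshelve epose (eps := @MkNatTrans D D (compF G K) (idF D) e _).
{ by move=> a b f; rewrite /= liftP !comp_assoc inv_r comp_idl. }
exists K, eta, eps; split; apply: nat_iso => x //=.
by apply: iso_reflect; rewrite liftP; apply: iso_inv.
Qed.

(** * Conditions holding eventually along the arrows out of an object *)

Section Eventually.
Variables (A : TwoCat) (C0 : A).

(** Persistence is asked for besides cofinality so that finitely many
    conditions can be achieved one after the other. *)
Definition eventual (Q : forall C : A, Hom2 C0 C -> Prop) : Prop :=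
  (forall (C C' : A) (w : Hom2 C0 C) (w' : Hom2 C C'), Q C w -> Q C' (w' · w)) /\
  (forall (C : A) (w : Hom2 C0 C), exists (C' : A) (w' : Hom2 C C'), Q C' (w' · w)).

Lemma eventual_forall (T : Type) (Q : T -> forall C : A, Hom2 C0 C -> Prop) :
  Finite T -> (forall t, eventual (Q t)) ->
  eventual (fun C w => forall t, Q t C w).
Proof.
move=> [l lfull] ev; split=> [C C' w w' q t|C w]; first exact: (proj1 (ev t)).
suff [C' [w' q]] : exists (C' : A) (w' : Hom2 C C'),
    forall t, In t l -> Q t C' (w' · w).
  by exists C', w' => t; apply/q/lfull.
elim: l {lfull} => [|t l [C1 [w1 q1]]]; first by exists C, (id1 C).
case: (proj2 (ev t) _ (w1 · w)) => C2 [w2 q2].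
exists C2, (w2 · w1) => t' [<-|il]; rewrite -assoc1 //.
exact/(proj1 (ev t'))/q1.
Qed.

Lemma eventual_and (Q R : forall C : A, Hom2 C0 C -> Prop) :
  eventual Q -> eventual R -> eventual (fun C w => Q C w /\ R C w).
Proof.
move=> [Qs Qd] [Rs Rd]; split=> [C C' w w' [q r]|C w]; first by split; auto.
case: (Qd _ w) => C1 [w1 q1]; case: (Rd _ (w1 · w)) => C2 [w2 r2].
by exists C2, (w2 · w1); rewrite -assoc1; split=> //; apply: Qs.
Qed.

Lemma eventual_arrow (Q : forall C : A, Hom2 C0 C -> Prop) :
  eventual Q -> exists (C : A) (w : Hom2 C0 C), Q C w.
Proof.
by case=> _ /(_ _ (id1 C0)) [C [w q]]; exists C, (w · id1 C0).
Qed.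

End Eventually.

(** * Objects with a common target *)

Definition comparable (A : TwoCat) (X Y : A) : Prop :=
  exists Z : A, inhabited (Hom2 X Z) /\ inhabited (Hom2 Y Z).

Lemma comparable_refl (A : TwoCat) (X : A) : comparable X X.
Proof. by exists X; split; split; apply: id1. Qed.

Lemma comparable_sym (A : TwoCat) (X Y : A) : comparable X Y -> comparable Y X.
Proof. by case=> Z [? ?]; exists Z. Qed.

(** F1 completes the span formed by the legs of two cospans sharing a foot. *)
Lemma comparable_trans (A : TwoCat) (X Y Z : A) :
  axiom_F1 A -> comparable X Y -> comparable Y Z -> comparable X Z.
Proof.
move=> F1 [C [[u] [v]]] [D [[s] [t]]].
case: (F1 _ _ _ v s) => E [x [y _]].
by exists E; split; split; [apply: comp1 x u|apply: comp1 y t].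
Qed.

(** The common target is built by adding one object at a time, keeping an arrow
    from B0: that arrow is what makes the next object comparable to the target
    already found.  Starting from B0 itself covers the empty family. *)
Lemma common_target (A : TwoCat) (T : Type) (B0 : A) (B : T -> A) :
  axiom_F1 A -> Finite T -> (forall t, comparable B0 (B t)) ->
  exists C : A, forall t, inhabited (Hom2 (B t) C).
Proof.
move=> F1 [l lfull] cmp.
suff [C [_ h]] : exists C : A, inhabited (Hom2 B0 C) /\
    forall t, In t l -> inhabited (Hom2 (B t) C).
  by exists C => t; apply/h/lfull.
elim: l {lfull} => [|t l [C [[w] h]]]; first by exists B0; split=> //; split; apply: id1.
case: (cmp t) => D [[u] [v]].
case: (F1 _ _ _ w u) => E [x [y _]].
exists E; split=> [|t' [<-|/h [z]]]; split;
  [apply: comp1 x w|apply: comp1 y v|apply: comp1 x z].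
Qed.

(** * Filtered cones *)

Section Cones.
Variables (A : TwoCat) (F : TwoFunctor A) (X : Category) (h : PseudoCone F X).

(** Up to the isomorphisms h_w, the arrow c is the image of an arrow living over
    the codomain of w. *)
Definition lifts (C C' : A) (x y : F C) (c : Hom (leg h C x) (leg h C y))
    (w : Hom2 C C') : Prop :=
  exists xi : Hom (Farr F w x) (Farr F w y),
    c ∘ tr h w x = tr h w y ∘ fmap (leg h C') xi.

(** When A is pseudo 2-filtered, these conditions together say that the functor
    L(F) → X induced by h is an equivalence. *)
Record filtered_cone : Prop := MkFilteredCone {
  fc_object : forall z : X, exists (C : A) (x : F C) (e : Hom (leg h C x) z), isIso e;
  fc_comparable : forall (B C : A) (x : F B) (y : F C),
    inhabited (Hom (leg h B x) (leg h C y)) -> comparable B C;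
  fc_lift : forall (C : A) (x y : F C) (c : Hom (leg h C x) (leg h C y)),
    exists (C' : A) (w : Hom2 C C'), lifts c w;
  fc_equal : forall (C : A) (x y : F C) (f g : Hom x y),
    fmap (leg h C) f = fmap (leg h C) g ->
    exists (C' : A) (w : Hom2 C C'), fmap (Farr F w) f = fmap (Farr F w) g }.

Lemma tr_natural (B C : A) (u : Hom2 B C) (x y : F B) (f : Hom x y) :
  tr h u y ∘ fmap (leg h C) (fmap (Farr F u) f) = fmap (leg h B) f ∘ tr h u x.
Proof. exact: (naturality (tr h u) f). Qed.

Lemma leg_fmap_eq (C C' : A) (w : Hom2 C C') (x y : F C) (f g : Hom x y) :
  fmap (leg h C) f = fmap (leg h C) g ->
  fmap (leg h C') (fmap (Farr F w) f) = fmap (leg h C') (fmap (Farr F w) g).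
Proof.
by move=> e; apply: (iso_mono (tr_at_iso h w y)); rewrite !tr_natural e.
Qed.

Lemma fmap_eq_comp (C C' C'' : A) (w : Hom2 C C') (w' : Hom2 C' C'')
    (x y : F C) (f g : Hom x y) :
  fmap (Farr F w') (fmap (Farr F w) f) = fmap (Farr F w') (fmap (Farr F w) g) ->
  fmap (Farr F (w' · w)) f = fmap (Farr F (w' · w)) g.
Proof. by move=> e; apply: pk_inj; rewrite !pk_Farr_comp e. Qed.

Lemma eventually_equal (C : A) (x y : F C) (f g : Hom x y) :
  filtered_cone -> fmap (leg h C) f = fmap (leg h C) g ->
  eventual (fun C' (w : Hom2 C C') => fmap (Farr F w) f = fmap (Farr F w) g).
Proof.
move=> fc e; split=> [C1 C2 w w' q|C1 w]; first by apply: fmap_eq_comp; rewrite q.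
case: (fc_equal fc (leg_fmap_eq w e)) => C2 [w' q].
by exists C2, w'; apply: fmap_eq_comp.
Qed.

(** Lifting c along w' w amounts to transporting c along w and then lifting the
    result c' along w'. *)
Lemma lifts_comp (C C1 C2 : A) (w : Hom2 C C1) (w' : Hom2 C1 C2) (x y : F C)
    (c : Hom (leg h C x) (leg h C y))
    (c' : Hom (leg h C1 (Farr F w x)) (leg h C1 (Farr F w y))) :
  c ∘ tr h w x = tr h w y ∘ c' -> lifts c' w' -> lifts c (w' · w).
Proof.
move=> e [xi exi].
exists (castH (eq_sym (Farr_comp_ob w' w x)) (eq_sym (Farr_comp_ob w' w y)) xi).
apply: pk_inj; rewrite fmap_castH !pk_comp pk_castH !(heq_pk (tr_comp h _ _ _)).
by rewrite -!pk_comp -comp_assoc -exi !comp_assoc e.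
Qed.

Lemma eventually_lifts (C : A) (x y : F C) (c : Hom (leg h C x) (leg h C y)) :
  filtered_cone -> eventual (fun C' (w : Hom2 C C') => lifts c w).
Proof.
move=> fc; split=> [C1 C2 w w' [xi e]|C1 w].
  apply: (lifts_comp e); exists (fmap (Farr F w') xi); symmetry; exact: tr_natural.
case: (fc_lift fc (inv (tr_at_iso h w y) ∘ (c ∘ tr h w x))) => C2 [w' q].
exists C2, w'; apply: lifts_comp q.
by rewrite !comp_assoc inv_r comp_idl.
Qed.

End Cones.

(** * The colimit cone is filtered *)

(** A homotopy between the images of f and g consists of two unrelated 2-cells a
    and b.  Axiom F3, applied to them, gives d : t1 ⇒ t2 such that
    (d w2)(t1 a) = (t2 b)(d w1); pasting d onto the homotopy therefore yields a
    square with the same 2-cell (t2 b)(d w1) on both sides, and cancelling it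
    against its naturality square leaves t2 w2 f = t2 w2 g. *)
Lemma fmap_eq_reflect (A : TwoCat) (F : TwoFunctor A) (C D : A)
    (w1 w2 : Hom2 C D) (a b : Hom w1 w2) (x y : F C) (f g : Hom x y) :
  axiom_F3 A -> isIso b ->
  Fcell F a y ∘ fmap (Farr F w1) f = fmap (Farr F w2) g ∘ Fcell F b x ->
  exists (E : A) (w : Hom2 C E), fmap (Farr F w) f = fmap (Farr F w) g.
Proof.
move=> F3 ib e.
(* F3 with u1 = u2 = id, up to the unit laws. *)
case: (F3 _ _ _ _ w1 w2 (id1 D) (id1 D) (id1 D ◁ a) (id1 D ◁ b)).
move=> E [t1 [t2 [d0 [id0 ed0]]]].
pose d : Hom t1 t2 := castH (idr1 t1) (idr1 t2) d0.
have ed : Fcell F d (Farr F w2 y) ∘ fmap (Farr F t1) (Fcell F a y) =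
    fmap (Farr F t2) (Fcell F b y) ∘ Fcell F d (Farr F w1 y).
  have wid t (c : Hom w1 w2) : pk (Fcell F (t ◁ (id1 D ◁ c)) y) =
      pk (fmap (Farr F t) (Fcell F c y)).
    by rewrite Fcell_wl; apply: pk_fmap; rewrite // Fcell_wl pk_Farr_id.
  have := f_equal (fun c => pk (Fcell F c y)) ed0.
  rewrite !Fcell_comp !pk_comp !pk_whisk !wid => {}ed0.
  by apply: pk_inj; rewrite !pk_comp !Fcell_castH.
exists E, (t2 · w2); apply: fmap_eq_comp.
have i : isIso (fmap (Farr F t2) (Fcell F b x) ∘ Fcell F d (Farr F w1 x)).
  apply: iso_comp; first exact/iso_fmap/Fcell_iso.
  exact/Fcell_iso/iso_castH.
apply: (iso_epi i).
have nd u v (k : Hom u v) : Fcell F d v ∘ fmap (Farr F t1) k =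
  fmap (Farr F t2) k ∘ Fcell F d u := naturality (Fcell F d) k.
have nb : Fcell F b y ∘ fmap (Farr F w1) f = fmap (Farr F w2) f ∘ Fcell F b x :=
  naturality (Fcell F b) f.
rewrite comp_assoc -fmap_comp -nb fmap_comp -comp_assoc -nd comp_assoc -ed.
by rewrite -comp_assoc -fmap_comp e fmap_comp comp_assoc nd -!comp_assoc nd.
Qed.

(** An arrow represented over a cospan (u, v) is represented over (s, s) as soon
    as both legs are isomorphic to s. *)
Lemma lifts_of_cells (A : TwoCat) (F : TwoFunctor A) (X : Category)
    (h : PseudoCone F X) (C D : A) (x y : F C)
    (c : Hom (leg h C x) (leg h C y)) (u v s : Hom2 C D)
    (xi : Hom (Farr F u x) (Farr F v y)) (a : Hom s u) (b : Hom s v) :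
  isIso b -> c ∘ tr h u x = tr h v y ∘ fmap (leg h D) xi -> lifts c s.
Proof.
move=> ib e.
exists (inv (@Fcell_iso _ F _ _ _ _ _ y ib) ∘ (xi ∘ Fcell F a x)).
rewrite -(tr_cell h a) -(tr_cell h b) -!comp_assoc -fmap_comp.
by rewrite [Fcell F b y ∘ _]comp_assoc inv_r comp_idl fmap_comp !comp_assoc e.
Qed.

(** FF1, applied to (id, u) and (id, v) for a premorphism (u, ξ, v) over C, gives
    s with s ≅ t u and s ≅ t v, so that the legs can be made equal; F3 enters
    through [fmap_eq_reflect]. *)
Lemma filtered_cone_lam (A : TwoCat) (hA : pre_two_filtered A)
    (F : TwoFunctor A) : pseudo_two_filtered A -> filtered_cone (lam hA F).
Proof.
case=> FF1 [_ F3]; split.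
- by case=> C x; exists C, x, (idm _); apply: iso_id.
- move=> B C x y [c]; case: (cls_surj c) => -[D u v xi] _.
  by exists D; split; split.
- move=> C x y c; rewrite -(cls_rep c).
  move: (rep c) => {c} p.
  case: (FF1 _ _ _ _ (id1 C) (pu p) (id1 C) (pv p)).
  move=> D [s [t [a [b [_ ib]]]]].
  pose xi := castH (eq_sym (Farr_comp_ob t (pu p) x))
    (eq_sym (Farr_comp_ob t (pv p) y)) (fmap (Farr F t) (pxi p)).
  have e : @comp (LCat hA F) _ (MkLOb x) (MkLOb y) (cls p)
        (tr (lam hA F) (t · pu p) x) =
      tr (lam hA F) (t · pv p) y ∘ fmap (leg (lam hA F) D) xi.
    apply: pk_inj; rewrite !pk_comp fmap_castH pk_castH.
    exact: (val_shift t (cls_decomp hA p)).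
  exists D, (s · id1 C); exact: (lifts_of_cells a ib e).
- move=> C x y f g /cls_homotopic [D [w1 [w2 [a [b [_ [ib e]]]]]]].
  pose a0 := castH (idr1 w1) (idr1 w2) a.
  pose b0 := castH (idr1 w1) (idr1 w2) b.
  apply: (@fmap_eq_reflect A F C D w1 w2 a0 b0 x y f g F3).
    exact: iso_castH.
  have := f_equal (fun k => pk k) e.
  have wid w k : pk (fmap (Farr F w) (fmap (Farr F (id1 C)) k)) =
    @pk (F D) _ _ (@fmap _ _ (Farr F w) x y k).
    by apply: pk_fmap => //; apply: pk_Farr_id.
  rewrite !pk_comp !pk_act /= !wid => {}e.
  by apply: pk_inj; rewrite !pk_comp !Fcell_castH.
Qed.

(** * A filtered cone is a colimit cone *)

Section Induced.
Variables (A : TwoCat) (hA : pre_two_filtered A) (F : TwoFunctor A).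
Variables (X : Category) (h : PseudoCone F X).
Hypotheses (FF1 : axiom_FF1 A) (fc : filtered_cone h).

(** Bring the two bases over a common C; a lifting of the resulting arrow of X
    along w : C → D is then the middle component of a premorphism. *)
Lemma induced_full (Y Z : LCat hA F) (d : Hom (induced hA h Y) (induced hA h Z)) :
  exists c : Hom Y Z, fmap (induced hA h) c = d.
Proof.
case: Y Z d => B x [B' y] /= d.
case: (fc_comparable fc (inhabits d)) => C [[u] [v]].
have [D [w [xi e]]] : exists (D : A) (w : Hom2 C D)
    (xi : Hom (Farr F w (Farr F u x)) (Farr F w (Farr F v y))),
  d ∘ (tr h u x ∘ tr h w (Farr F u x)) =
  (tr h v y ∘ tr h w (Farr F v y)) ∘ fmap (leg h D) xi.
  case: (fc_lift fc (inv (tr_at_iso h v y) ∘ (d ∘ tr h u x)))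
    => D [w [xi e]].
  exists D, w, xi.
  by rewrite -comp_assoc -e !comp_assoc inv_r comp_idl.
pose p := @MkPreMor A F (MkLOb x) (MkLOb y) D (w · u) (w · v)
  (castH (eq_sym (Farr_comp_ob w u x)) (eq_sym (Farr_comp_ob w v y)) xi).
exists (cls p); rewrite pre_val_rep; symmetry.
apply: (@pre_val_unique _ _ _ _ _ _ p).
apply: pk_inj; rewrite /= fmap_castH !pk_comp pk_castH !(heq_pk (tr_comp h _ _ _)).
by rewrite -!pk_comp e.
Qed.

(** FF1 makes the cospans of two premorphisms p and q agree up to invertible
    2-cells.  The arrows f and g compared by a homotopy then have equal images in
    X, hence become equal after some w, and w times the 2-cells is a homotopy. *)
Lemma induced_faithful (Y Z : LCat hA F) (c d : Hom Y Z) :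
  fmap (induced hA h) c = fmap (induced hA h) d -> c = d.
Proof.
rewrite /= -(cls_rep c) -(cls_rep d) !pre_val_rep.
move: (rep c) (rep d) => {c d} p q epq; apply: (cls_eq hA).
case: (FF1 (pv p) (pv q) (pu p) (pu q)) => D [w1 [w2 [a [b [ia ib]]]]].
pose f := act F a (pt Z) ∘ fmap (Farr F w1) (pxi p).
pose g := fmap (Farr F w2) (pxi q) ∘ act F b (pt Y).
have e : fmap (leg h D) f = fmap (leg h D) g.
  pose t := castH (f_equal (leg h D) (Farr_comp_ob w2 (pv q) (pt Z))) eq_refl
    (tr h (w2 · pv q) (pt Z)).
  have it : isIso t by apply: iso_castH; apply: tr_at_iso.
  apply: (iso_mono it); apply: pk_inj; rewrite /f /g !fmap_comp !pk_comp pk_castH.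
  have pa C C' B (w : Hom2 C D) (v : Hom2 B C) (w' : Hom2 C' D) (v' : Hom2 B C')
      (k : Hom (w · v) (w' · v')) (z : F B) :
      pk (fmap (leg h D) (act F k z)) = pk (fmap (leg h D) (Fcell F k z)).
    by apply: pk_fmap => //; rewrite pk_act.
  rewrite !pa mulA -(pk_comp (tr h _ _)) tr_cell.
  rewrite -(val_shift w1 (pre_valE h p)) epq mulA -(val_shift w2 (pre_valE h q)).
  by rewrite -mulA -(pk_comp (tr h _ _)) tr_cell.
case: (fc_equal fc e) => E [w ew].
apply: (@homotopicI _ _ _ _ _ _ E (w · w1) (w · w2)
  (castH (assoc1 _ _ _) (assoc1 _ _ _) (w ◁ a))
  (castH (assoc1 _ _ _) (assoc1 _ _ _) (w ◁ b)));
  try by apply/iso_castH/wl_iso.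
move: (f_equal (fun k => pk k) ew).
by rewrite /f /g !pkFE.
Qed.

Lemma induced_equivalence : is_equivalence (induced hA h).
Proof.
apply: equivalence_of_fully_faithful.
- exact: induced_faithful.
- exact: induced_full.
- move=> z; case: (fc_object fc z) => C [x e]; by exists (MkLOb x).
Qed.

End Induced.

(** * Filtered cones and functors from a finite category *)

Section Power.
Variables (A : TwoCat) (F : TwoFunctor A) (X : Category) (h : PseudoCone F X).
Variable P : Category.
Hypotheses (fc : filtered_cone h) (finP : finite_category P).

Lemma eventually_natural (C : A) (K L : Functor P (F C))
    (xi : forall i, Hom (K i) (L i)) :
  (forall i j (f : Hom i j), fmap (leg h C) (xi j ∘ fmap K f) =
     fmap (leg h C) (fmap L f ∘ xi i)) ->
  exists (C' : A) (w : Hom2 C C'), forall i j (f : Hom i j),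
    fmap (Farr F w) (xi j ∘ fmap K f) = fmap (Farr F w) (fmap L f ∘ xi i).
Proof.
move=> e; apply: eventual_arrow.
apply: eventual_forall => [|i]; first exact: (proj1 finP).
apply: eventual_forall => [|j]; first exact: (proj1 finP).
apply: eventual_forall => [|f]; first exact: (proj2 finP).
exact: (eventually_equal fc).
Qed.

Lemma power_equal (C : A) (K L : Functor P (F C)) (s t : NatTrans K L) :
  fmap (leg (powCone h P) C) s = fmap (leg (powCone h P) C) t ->
  exists (C' : A) (w : Hom2 C C'),
    fmap (Farr (powF F P) w) s = fmap (Farr (powF F P) w) t.
Proof.
move=> e.
have [C' [w ew]] : exists (C' : A) (w : Hom2 C C'), forall i,
    fmap (Farr F w) (s i) = fmap (Farr F w) (t i).
  apply: eventual_arrow; apply: eventual_forall => [|i]; first exact: (proj1 finP).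
  apply: (eventually_equal fc).
  have := f_equal (fun r => component r i) e.
  by rewrite /= !comp_idl.
by exists C', w; apply: nat_ext => i; rewrite /= !comp_idl.
Qed.

(** The components of s are lifted simultaneously along w1.  The lifts need not
    be natural, but their images in X are, so that they become natural after a
    further w2. *)
Lemma power_lift (C : A) (K L : Functor P (F C))
    (s : NatTrans (compF (leg h C) K) (compF (leg h C) L)) :
  exists (C' : A) (w : Hom2 C C'), @lifts _ _ _ (powCone h P) C C' K L s w.
Proof.
have [C1 [w1 ex1]] : exists (C' : A) (w : Hom2 C C'), forall i, lifts (s i) w.
  apply: eventual_arrow; apply: eventual_forall => [|i]; first exact: (proj1 finP).
  exact: eventually_lifts.
pose xi i := proj1_sig (constructive_indefinite_description _ (ex1 i)).
have xiP i : s i ∘ tr h w1 (K i) = tr h w1 (L i) ∘ fmap (leg h C1) (xi i).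
  by rewrite /xi; case: constructive_indefinite_description.
pose K1 := compF (Farr F w1) K; pose L1 := compF (Farr F w1) L.
have nc i j (f : Hom i j) :
    fmap (leg h C1) (xi j) ∘ fmap (leg h C1) (fmap K1 f) =
    fmap (leg h C1) (fmap L1 f) ∘ fmap (leg h C1) (xi i).
  apply: (iso_mono (tr_at_iso h w1 (L j))).
  rewrite !comp_assoc -xiP tr_natural -[RHS]comp_assoc -xiP -comp_assoc tr_natural.
  by rewrite !comp_assoc (naturality s f).
have [i j f|C2 [w2 nat2]] := @eventually_natural C1 K1 L1 xi.
  by rewrite !fmap_comp nc.
pose c := @MkNatTrans P X (compF (leg h C1) K1) (compF (leg h C1) L1)
  (fun i => fmap (leg h C1) (xi i)) nc.
have nxi i j (f : Hom i j) : fmap (Farr F w2) (xi j) ∘ fmap (Farr F w2) (fmap K1 f) =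
    fmap (Farr F w2) (fmap L1 f) ∘ fmap (Farr F w2) (xi i).
  by rewrite -!fmap_comp; exact: nat2.
pose xi2 := @MkNatTrans P (F C2) (compF (Farr F w2) K1) (compF (Farr F w2) L1)
  (fun i => fmap (Farr F w2) (xi i)) nxi.
exists C2, (w2 · w1); apply: (@lifts_comp _ _ _ (powCone h P) _ _ _ _ _ _ _ _ c).
  by apply: nat_ext => i; exact: xiP.
exists xi2; apply: nat_ext => i /=.
by rewrite comp_idl tr_natural.
Qed.

(** A diagram D whose objects all come from one FC: lift its arrows along a
    common w1, then enforce functoriality of the lifts, which is a finite set of
    equations holding in X, by a further w2. *)
Lemma power_object (C : A) (D : Functor P X) (x : P -> F C)
    (e : forall i, Hom (leg h C (x i)) (D i)) :
  (forall i, isIso (e i)) ->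
  exists (C' : A) (K : Functor P (F C')) (t : NatTrans (compF (leg h C') K) D),
    @isIso (FunCat P X) _ _ t.
Proof.
move=> ie.
pose c i j (f : Hom i j) : Hom (leg h C (x i)) (leg h C (x j)) :=
  inv (ie j) ∘ (fmap D f ∘ e i).
have [C1 [w1 ex1]] : exists (C' : A) (w : Hom2 C C'),
    forall i j (f : Hom i j), lifts (c i j f) w.
  apply: eventual_arrow.
  apply: eventual_forall => [|i]; first exact: (proj1 finP).
  apply: eventual_forall => [|j]; first exact: (proj1 finP).
  apply: eventual_forall => [|f]; first exact: (proj2 finP).
  exact: eventually_lifts.
pose xi i j f := proj1_sig (constructive_indefinite_description _ (ex1 i j f)).
pose e1 i := e i ∘ tr h w1 (x i).
have ie1 i : isIso (e1 i) by apply: iso_comp => //; apply: tr_at_iso.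
have xiP i j f : e1 j ∘ fmap (leg h C1) (xi i j f) = fmap D f ∘ e1 i.
  have : c i j f ∘ tr h w1 (x i) = tr h w1 (x j) ∘ fmap (leg h C1) (xi i j f).
    by rewrite /xi; case: constructive_indefinite_description.
  by rewrite /e1 -comp_assoc => <-; rewrite !comp_assoc inv_r comp_idl.
(* Otherwise rewriting with associativity would split e1. *)
clearbody e1.
have [C2 [w2 [w2_id w2_comp]]] : exists (C' : A) (w : Hom2 C1 C'),
    (forall i, fmap (Farr F w) (xi i i (idm i)) = fmap (Farr F w) (idm _)) /\
    (forall i j k (f : Hom i j) (g : Hom j k),
      fmap (Farr F w) (xi i k (g ∘ f)) = fmap (Farr F w) (xi j k g ∘ xi i j f)).
  apply: eventual_arrow; apply: eventual_and.
    apply: eventual_forall => [|i]; first exact: (proj1 finP).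
    apply: (eventually_equal fc); apply: (iso_mono (ie1 i)).
    by rewrite xiP !fmap_id comp_idl comp_idr.
  apply: eventual_forall => [|i]; first exact: (proj1 finP).
  apply: eventual_forall => [|j]; first exact: (proj1 finP).
  apply: eventual_forall => [|k]; first exact: (proj1 finP).
  apply: eventual_forall => [|f]; first exact: (proj2 finP).
  apply: eventual_forall => [|g]; first exact: (proj2 finP).
  apply: (eventually_equal fc); apply: (iso_mono (ie1 k)).
  by rewrite xiP !fmap_comp comp_assoc xiP -!comp_assoc xiP.
have K_id i : fmap (Farr F w2) (xi i i (idm i)) = idm (Farr F w2 (Farr F w1 (x i))).
  by rewrite w2_id fmap_id.
have K_comp i j k (g : Hom j k) (f : Hom i j) : fmap (Farr F w2) (xi i k (g ∘ f)) =
    fmap (Farr F w2) (xi j k g) ∘ fmap (Farr F w2) (xi i j f).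
  by rewrite w2_comp fmap_comp.
pose K := @MkFunctor P (F C2) (fun i => Farr F w2 (Farr F w1 (x i)))
  (fun i j f => fmap (Farr F w2) (xi i j f)) K_id K_comp.
pose t i : Hom (compF (leg h C2) K i) (D i) := e1 i ∘ tr h w2 (Farr F w1 (x i)).
have t_nat i j (f : Hom i j) :
    t j ∘ fmap (compF (leg h C2) K) f = fmap D f ∘ t i.
  by rewrite /t /= -comp_assoc tr_natural !comp_assoc xiP.
exists C2, K, (MkNatTrans t_nat); apply: nat_iso => i.
by apply: iso_comp => //; apply: tr_at_iso.
Qed.

End Power.

(** Beyond its finiteness, the shape of P matters only here.  For a functor D,
    the bases of objects representing the D(i) are pairwise comparable: by F0, or
    because arrows of D make the bases at both ends comparable and P is
    connected.  F0 also provides the comparability of bases when P is empty,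
    where there are no components to deduce it from. *)
Lemma filtered_cone_powCone (A : TwoCat) (F : TwoFunctor A) (X : Category)
    (h : PseudoCone F X) (P : Category) :
  axiom_F1 A -> finite_category P -> filtered_cone h ->
  (inhabited A /\ axiom_F0 A) \/ connected_category P ->
  filtered_cone (powCone h P).
Proof.
move=> F1 finP fc hyp.
split.
- move=> D.
  pose a i := constructive_indefinite_description _ (fc_object fc (D i)).
  pose B i := proj1_sig (a i).
  have [x [e ie]] : exists (x : forall i, F (B i))
      (e : forall i, Hom (leg h (B i) (x i)) (D i)), forall i, isIso (e i).
    pose b i := constructive_indefinite_description _ (proj2_sig (a i)).
    pose c i := constructive_indefinite_description _ (proj2_sig (b i)).
    by exists (fun i => proj1_sig (b i)), (fun i => proj1_sig (c i)) => i;
      apply: (proj2_sig (c i)).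
  have [B0 cmp] : exists B0, forall i, comparable B0 (B i).
    case: hyp => [[[B0] F0]|[[i0] con]].
      by exists B0 => i; apply: F0.
    have step i j (f : Hom i j) : comparable (B i) (B j).
      apply: (fc_comparable fc (x := x i) (y := x j)); split.
      exact: (inv (ie j) ∘ (fmap D f ∘ e i)).
    exists (B i0) => i.
    by elim: (con i0 i) => {i} [i j [f]|i|i j _|i j k _ ij _];
      [exact: step f|exact: comparable_refl|exact: comparable_sym
      |exact: comparable_trans ij].
  case: (common_target F1 (proj1 finP) cmp) => C ex_u.
  pose u i : Hom2 (B i) C :=
    proj1_sig (constructive_indefinite_description (fun _ => True)
      (let: inhabits u := ex_u i in ex_intro _ u I)).
  case: (@power_object _ _ _ h P fc finP C D (fun i => Farr F (u i) (x i))
    (fun i => e i ∘ tr h (u i) (x i))) => [i|C' [K [t it]]].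
    by apply: iso_comp => //; apply: tr_at_iso.
  by exists C', K, t.
- move=> B C K L [s].
  case: hyp => [[_ F0]|[[i] _]]; first exact: F0.
  exact: (fc_comparable fc (inhabits (component s i))).
- move=> C K L s; exact: (power_lift fc finP).
- move=> C K L s t; exact: (power_equal fc finP).
Qed.

Theorem theorem2p8 (A : TwoCat) (hA : pre_two_filtered A) (F : TwoFunctor A)
    (P : Category) (hP : finite_category P) :
  two_filtered A \/ (pseudo_two_filtered A /\ connected_category P) ->
  is_equivalence (Diamond hA F P).
Proof.
move=> hyp.
have ps : pseudo_two_filtered A by case: hyp => [[]|[]].
apply: induced_equivalence; first exact: (proj1 ps).
apply: filtered_cone_powCone (proj1 hA) hP (filtered_cone_lam hA F ps) _.
by case: hyp => [[_]|[_]]; [left|right].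
Qed.
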